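(* Let $c_*$ denote the least possible absolute constant $c$ such that $$\mathsf P(S_n\ge x)\le c\,\mathsf P(Z\ge x)\qquad\text{for all }x\in\mathbb R,$$ for all $n\in\{1,2,\dots\}$ and all real numbers $a_1,\dots,a_n$ with $a_1^2+\dots+a_n^2=1$, where $S_n:=a_1\varepsilon_1+\dots+a_n\varepsilon_n$. Then $$c_*\in[c_1,c_2],$$ where $$c_1:=\frac1{4\overline{\Phi}(\sqrt2)}\quad\text{and}\quad c_2:=c_1\cdot\Big(1+\tfrac1{250}\big(1+r(\sqrt3\,)\big)\Big);$$ here, numerically, $[c_1,c_2]\approx[3.18,3.22]$ and $c_2\approx c_1\cdot1.01$.
   Context: $\varepsilon_1,\dots,\varepsilon_n$ are independent Rademacher random variables, i.e. $\mathsf P(\varepsilon_i=1)=\mathsf P(\varepsilon_i=-1)=\frac12$ for all $i$. $Z\sim N(0,1)$ is a standard normal random variable. $\varphi(x):=e^{-x^2/2}/\sqrt{2\pi}$ is its density, $\overline{\Phi}(x):=\mathsf P(Z\ge x)=\int_x^\infty\varphi(u)\,du$ its tail function, and $r:=\varphi/\overline{\Phi}$ the inverse Mills ratio. *)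

(* Defs.v *)
From HB Require Import structures.
From mathcomp Require Import all_boot all_order all_algebra.
From mathcomp Require Import all_classical all_reals all_analysis.

Set Implicit Arguments.
Unset Strict Implicit.
Unset Printing Implicit Defensive.

Import Order.TTheory GRing.Theory Num.Theory.
Import numFieldNormedType.Exports.

Local Open Scope classical_set_scope.
Local Open Scope ring_scope.

(* Mutual independence of a finite family of real random variables: the
   product rule for every finite subfamily and all Borel sets. *)
Definition mutually_independent (R : realType) (d : measure_display)
    (T : measurableType d) (P : probability T R) (n : nat)
    (X : 'I_n -> {RV P >-> R}) : Prop :=
  forall (J : {set 'I_n}) (B : 'I_n -> set R),
    (forall i, measurable (B i)) ->
    P [set w | forall i, i \in J -> B i (X i w)] =
    (\prod_(i in J) P (X i @^-1` B i))%E.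

Definition rademacher (R : realType) (d : measure_display)
    (T : measurableType d) (P : probability T R) (X : {RV P >-> R}) : Prop :=
  P [set w | X w = 1] = (2^-1)%:E /\ P [set w | X w = -1] = (2^-1)%:E.

Definition phi (R : realType) (x : R) : R :=
  expR (- x ^+ 2 / 2) / Num.sqrt (2 * pi).

(* P(Z >= x) for Z standard normal. *)
Definition Phibar (R : realType) (x : R) : R :=
  fine (normal_prob (0 : R) 1 `[x, +oo[).

Definition mills (R : realType) (x : R) : R := phi x / Phibar x.

Lemma phiE (R : realType) (x : R) : phi x = normal_pdf 0 1 x.
Proof.
rewrite normal_pdfE ?oner_neq0// /phi /normal_fun /normal_peak.
by rewrite subr0 expr1n mul1r mulr2n mulrC -[1 + 1]/(2 : R) mulr_natl.
Qed.

Lemma PhibarE (R : realType) (x : R) :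
  Phibar x = \int[lebesgue_measure]_(u in `[x, +oo[) phi u.
Proof.
rewrite /Phibar /normal_prob /Rintegral; congr fine.
by apply: eq_integral => u _; rewrite phiE.
Qed.

(* [c] is an absolute constant: it does not depend on n, on the coefficients,
   on x, or on the probability space carrying the Rademacher variables. *)
Definition admissible (R : realType) (c : R) : Prop :=
  forall (n : nat) (a : 'I_n -> R),
    (0 < n)%N -> \sum_(i < n) a i ^+ 2 = 1 ->
  forall (d : measure_display) (T : measurableType d) (P : probability T R)
      (eps : 'I_n -> {RV P >-> R}),
    mutually_independent eps -> (forall i, rademacher (eps i)) ->
  forall x : R,
    (P [set w | (x <= \sum_(i < n) a i * eps i w)%R] <= (c * Phibar x)%:E)%E.

Definition is_least_admissible (R : realType) (c : R) : Prop :=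
  admissible c /\ forall c' : R, admissible c' -> c <= c'.

Definition c1 (R : realType) : R := 1 / (4 * Phibar (Num.sqrt 2)).

Definition c2 (R : realType) : R :=
  c1 R * (1 + 1 / 250 * (1 + mills (Num.sqrt 3))).

(* [x] is [m / 100] correctly rounded to two decimals. *)
Definition approx2 (R : realType) (x : R) (m : nat) : Prop :=
  `|x - m%:R / 100| <= 1 / 200.

(* Main.v *)
Require Import Defs.
From HB Require Import structures.
From mathcomp Require Import all_boot all_order all_algebra.
From mathcomp Require Import ring lra.
From mathcomp Require Import all_classical all_reals all_analysis.
From mathcomp Require Import measurable_realfun unstable.

(** Write P for the standard Gaussian tail, normalised by q = 4 P (sqrt 2), so
that c1 = 1 / q. The least admissible constant is c1 itself; the enclosure by
c1 and c2 and the three roundings then only ask for numerical bounds on P.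

No constant below c1 is admissible: for two coefficients equal to 1 / sqrt 2
the sum reaches sqrt 2 with probability 1/4 = c1 P (sqrt 2).

For the upper bound, independence turns the probability into an average over
sign patterns (prob_sgn_tail), and the claim becomes sgn_tail l x <= P x / q for
every list l of coefficients whose squares add up to 1 (sgn_tail_le_Phibar). It
is proved by induction on the number of coefficients.

- For x <= sqrt 2, symmetry (a tail beyond a positive point is at most 1/2) and
  Chebyshev's bound 1 / (2 x^2) suffice, since x^2 P x is unimodal on
  [1, sqrt 2]. At sqrt 2 both Chebyshev's bound and P x / q are 1/4.

- For x >= sqrt 3, condition on the sign of one coefficient a. The remaining
  sum, rescaled by s = sqrt (1 - a^2), satisfies the induction hypothesis at
  (x - a) / s and (x + a) / s, and P ((x - a) / s) + P ((x + a) / s) <= 2 P x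
  (Phibar_split_le): the left side is nonincreasing in a, because
  t / (1 - t^2 / 3) <= artanh t for t = a x < 1.

- Between sqrt 2 and sqrt 3 that inequality fails for small a, and the argument
  depends on the largest coefficient. If all squares are at most 9/25, the
  moments up to order eight decide (sgn_tail_small_coeff): a quartic in the
  square of the sum majorises the indicator of the two-sided tail, and its mean
  is bounded by the formula for equal coefficients (sgn_tail_moment). If some
  coefficient b exceeds 3/5, condition on its sign. The rescaled remainder has
  to exceed some u with u^2 >= x^2 - 1 > 1, which has probability at most 1/3
  (sgn_tail_le_third) and at most 1 / (2 (x^2 - 1)) by Chebyshev, or some
  v > 5/2, where the induction hypothesis leaves next to nothing; Phibar_room_left
  and Phibar_room_right say that the sum of both fits below 2 P x / q.

All numerical bounds come from alternating partial sums of exp and of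
the integral of exp (- u^2 / 2), and from two rational bounds of Mills ratio at
2, which together enclose phi 0 = 1 / sqrt (2 pi) (phi0_bounds). *)

Set Implicit Arguments.
Unset Strict Implicit.
Unset Printing Implicit Defensive.

Import Order.TTheory GRing.Theory Num.Theory.
Import numFieldNormedType.Exports.

Local Open Scope classical_set_scope.
Local Open Scope ring_scope.

(** * Averages over independent signs *)

Section SignAverages.
Variable R : realFieldType.
Implicit Types (l : seq R) (f g : R -> R) (a c x y : R).

(** Recursion on the list of coefficients makes conditioning on one sign a matter of
unfolding, and normalisation, permutation and sign change of the coefficients
become operations on lists. *)
Fixpoint sgn_mean l f : R :=
  if l is a :: l' then
    (sgn_mean l' (fun s => f (a + s)) + sgn_mean l' (fun s => f (- a + s))) / 2
  else f 0.

Definition sgn_tail l x : R := sgn_mean l (fun s => (x <= s)%R%:R).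

Definition psum (k : nat) l : R := \sum_(a <- l) a ^+ k.

Lemma eq_sgn_mean l f g : f =1 g -> sgn_mean l f = sgn_mean l g.
Proof.
elim: l f g => [|a l IH] f g fg /=; first exact: fg.
by congr ((_ + _) / 2); apply: IH => s.
Qed.

Lemma le_sgn_mean l f g : (forall s, f s <= g s) -> sgn_mean l f <= sgn_mean l g.
Proof.
elim: l f g => [|a l IH] f g fg /=; first exact: fg.
by rewrite ler_pM2r ?invr_gt0 ?ltr0n// lerD// IH.
Qed.

Lemma sgn_meanD l f g : sgn_mean l (fun s => f s + g s) = sgn_mean l f + sgn_mean l g.
Proof.
elim: l f g => [|a l IH] f g //=.
rewrite (IH (fun s => f (a + s))) (IH (fun s => f (- a + s))).
by field.
Qed.

Lemma sgn_meanZ l c f : sgn_mean l (fun s => c * f s) = c * sgn_mean l f.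
Proof.
elim: l f => [|a l IH] f //=.
rewrite (IH (fun s => f (a + s))) (IH (fun s => f (- a + s))).
by field.
Qed.

Lemma sgn_mean_cst l c : sgn_mean l (fun=> c) = c.
Proof. by elim: l => [|a l IH] //=; rewrite IH; field. Qed.

Lemma sgn_mean_mid l1 a l2 f :
  sgn_mean (l1 ++ a :: l2) f = sgn_mean (a :: l1 ++ l2) f.
Proof.
elim: l1 f => [|b l1 IH] f //=; rewrite !IH /=.
rewrite (@eq_sgn_mean _ (fun s => f (b + (a + s))) (fun s => f (a + (b + s))));
  last by move=> s; rewrite addrCA.
rewrite (@eq_sgn_mean _ (fun s => f (b + (- a + s))) (fun s => f (- a + (b + s))));
  last by move=> s; rewrite addrCA.
rewrite (@eq_sgn_mean _ (fun s => f (- b + (a + s))) (fun s => f (a + (- b + s))));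
  last by move=> s; rewrite addrCA.
rewrite (@eq_sgn_mean _ (fun s => f (- b + (- a + s)))
  (fun s => f (- a + (- b + s)))); last by move=> s; rewrite addrCA.
by field.
Qed.

Lemma perm_sgn_mean l l' f : perm_eq l l' -> sgn_mean l f = sgn_mean l' f.
Proof.
elim: l l' f => [|a l IH] l' f.
  by move/perm_size/esym/eqP; rewrite size_eq0 => /eqP ->.
move=> pl; have al' : a \in l' by rewrite -(perm_mem pl) mem_head.
case/splitPr: al' pl => l1 l2 pl; rewrite sgn_mean_mid /=.
have {}pl : perm_eq l (l1 ++ l2).
  by move: pl; rewrite -(cat1s a l2) perm_sym perm_catCA perm_cons perm_sym.
by rewrite !(IH _ _ pl).
Qed.

Lemma sgn_meanN l f : sgn_mean l (fun s => f (- s)) = sgn_mean l f.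
Proof.
elim: l f => [|a l IH] f /=; first by rewrite oppr0.
rewrite -(IH (fun s => f (a + s))) -(IH (fun s => f (- a + s))) addrC.
by congr ((_ + _) / 2); apply: eq_sgn_mean => s; rewrite opprD ?opprK.
Qed.

Lemma sgn_mean_scale l c f :
  sgn_mean [seq c * a | a <- l] f = sgn_mean l (fun s => f (c * s)).
Proof.
elim: l f => [|a l IH] f /=; first by rewrite mulr0.
rewrite !IH; congr ((_ + _) / 2); apply: eq_sgn_mean => s.
  by rewrite mulrDr.
by rewrite mulrDr mulrN.
Qed.

Lemma sgn_tail_cons a l x :
  sgn_tail (a :: l) x = (sgn_tail l (x - a) + sgn_tail l (x + a)) / 2.
Proof.
rewrite /sgn_tail /=; congr ((_ + _) / 2); apply: eq_sgn_mean => s.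
  by rewrite lerBlDl.
by rewrite [- a + s]addrC lerBrDr.
Qed.

Lemma sgn_tail_norm a l x : sgn_tail (`|a| :: l) x = sgn_tail (a :: l) x.
Proof.
rewrite !sgn_tail_cons; case: (ger0P a) => // _.
by rewrite opprK addrC.
Qed.

Lemma sgn_tail_ge0 l x : 0 <= sgn_tail l x.
Proof.
by rewrite -[leLHS](sgn_mean_cst l); apply: le_sgn_mean => s; rewrite ler0n.
Qed.

Lemma sgn_tail_le1 l x : sgn_tail l x <= 1.
Proof.
by rewrite -[leRHS](sgn_mean_cst l); apply: le_sgn_mean => s; rewrite lern1 leq_b1.
Qed.

Lemma sgn_tail_anti l x y : x <= y -> sgn_tail l y <= sgn_tail l x.
Proof.
move=> xy; apply: le_sgn_mean => s.
have [ys|_] := boolP (y <= s); last by rewrite ler0n.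
by rewrite (le_trans xy ys).
Qed.

Lemma sgn_tail_scale l c x : 0 < c ->
  sgn_tail [seq c * a | a <- l] (c * x) = sgn_tail l x.
Proof.
move=> c0; rewrite /sgn_tail sgn_mean_scale; apply: eq_sgn_mean => s.
by rewrite ler_pM2l.
Qed.

(** Symmetry of the sign distribution makes one tail half of a two-sided one. *)
Lemma sgn_tail_two_sided l x f :
  (forall s, 0 <= f s) -> (forall s, x <= s -> 1 <= f s) ->
  (forall s, f (- s) = f s) -> 0 < x -> sgn_tail l x <= sgn_mean l f / 2.
Proof.
move=> f0 f1 fN x0.
have e : sgn_tail l x = sgn_mean l (fun s => (x <= - s)%R%:R).
  by rewrite (sgn_meanN l (fun s => (x <= s)%R%:R)).
rewrite ler_pdivlMr ?ltr0n// mulr_natr mulr2n {2}e -sgn_meanD.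
apply: le_sgn_mean => s.
have [xs|xs] := boolP (x <= s); have [xNs|xNs] := boolP (x <= - s) => /=.
- by exfalso; move: x0 xs xNs; lra.
- by rewrite addr0 f1.
- by rewrite add0r -fN f1.
- by rewrite addr0 f0.
Qed.

Lemma sgn_tail_le_half l x : 0 < x -> sgn_tail l x <= 1 / 2.
Proof.
move=> x0; rewrite -[X in X / 2](sgn_mean_cst l).
by apply: sgn_tail_two_sided.
Qed.

Lemma sgn_mean_even_poly l (c0 c1 c2 c3 c4 : R) :
  sgn_mean l (fun s => c0 + c1 * s ^+ 2 + c2 * s ^+ 4 + c3 * s ^+ 6 + c4 * s ^+ 8)
  = c0 + c1 * sgn_mean l (fun s => s ^+ 2) + c2 * sgn_mean l (fun s => s ^+ 4)
    + c3 * sgn_mean l (fun s => s ^+ 6) + c4 * sgn_mean l (fun s => s ^+ 8).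
Proof. by rewrite !sgn_meanD !sgn_meanZ sgn_mean_cst. Qed.

Lemma psum_cons k a l : psum k (a :: l) = a ^+ k + psum k l.
Proof. by rewrite /psum big_cons. Qed.

Lemma psum_nil k : psum k [::] = 0.
Proof. by rewrite /psum big_nil. Qed.

Lemma sgn_mean_cons a l f :
  sgn_mean (a :: l) f = sgn_mean l (fun s => (f (a + s) + f (- a + s)) / 2).
Proof.
rewrite /= -sgn_meanD -[RHS]/(_) mulrC -sgn_meanZ.
by apply: eq_sgn_mean => s; rewrite mulrC.
Qed.

Lemma sgn_mean_pow2 l : sgn_mean l (fun s => s ^+ 2) = psum 2 l.
Proof.
elim: l => [|a l IH]; first by rewrite psum_nil /= expr0n.
rewrite sgn_mean_cons (@eq_sgn_mean _ _
  (fun s => a ^+ 2 + 1 * s ^+ 2 + 0 * s ^+ 4 + 0 * s ^+ 6 + 0 * s ^+ 8)).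
  by rewrite sgn_mean_even_poly psum_cons IH; ring.
by move=> s; field.
Qed.

(** The even moments up to order eight are given by the moment-cumulant formula: the
cumulants of orders 2, 4, 6, 8 of a sign are 1, -2, 16, -272, and those of a sum
are the corresponding multiples of the power sums. *)
Lemma sgn_mean_pow4 l :
  sgn_mean l (fun s => s ^+ 4) = 3 * psum 2 l ^+ 2 - 2 * psum 4 l.
Proof.
elim: l => [|a l IH]; first by rewrite !psum_nil /= !expr0n /=; ring.
rewrite sgn_mean_cons (@eq_sgn_mean _ _
  (fun s => a ^+ 4 + (6 * a ^+ 2) * s ^+ 2 + 1 * s ^+ 4 + 0 * s ^+ 6 + 0 * s ^+ 8)).
  by rewrite sgn_mean_even_poly !psum_cons IH sgn_mean_pow2; ring.
by move=> s; field.
Qed.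

Lemma sgn_mean_pow6 l :
  sgn_mean l (fun s => s ^+ 6)
  = 15 * psum 2 l ^+ 3 - 30 * psum 2 l * psum 4 l + 16 * psum 6 l.
Proof.
elim: l => [|a l IH]; first by rewrite !psum_nil /= !expr0n /=; ring.
rewrite sgn_mean_cons (@eq_sgn_mean _ _
  (fun s => a ^+ 6 + (15 * a ^+ 4) * s ^+ 2 + (15 * a ^+ 2) * s ^+ 4
            + 1 * s ^+ 6 + 0 * s ^+ 8)).
  by rewrite sgn_mean_even_poly !psum_cons IH sgn_mean_pow2 sgn_mean_pow4; ring.
by move=> s; field.
Qed.

Lemma sgn_mean_pow8 l :
  sgn_mean l (fun s => s ^+ 8)
  = 105 * psum 2 l ^+ 4 - 420 * psum 2 l ^+ 2 * psum 4 l + 140 * psum 4 l ^+ 2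
    + 448 * psum 2 l * psum 6 l - 272 * psum 8 l.
Proof.
elim: l => [|a l IH]; first by rewrite !psum_nil /= !expr0n /=; ring.
rewrite sgn_mean_cons (@eq_sgn_mean _ _
  (fun s => a ^+ 8 + (28 * a ^+ 6) * s ^+ 2 + (70 * a ^+ 4) * s ^+ 4
            + (28 * a ^+ 2) * s ^+ 6 + 1 * s ^+ 8)).
  rewrite sgn_mean_even_poly !psum_cons IH sgn_mean_pow2 sgn_mean_pow4
    sgn_mean_pow6; ring.
by move=> s; field.
Qed.

Lemma psum2_ge0 l : 0 <= psum 2 l.
Proof. by apply: sumr_ge0 => a _; rewrite sqr_ge0. Qed.

Lemma psum_scale k c l : psum k [seq c * a | a <- l] = c ^+ k * psum k l.
Proof.
by rewrite /psum big_map mulr_sumr; apply: eq_bigr => a _; rewrite exprMn.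
Qed.

Lemma perm_psum k l l' : perm_eq l l' -> psum k l = psum k l'.
Proof. exact: perm_big. Qed.

(** A variance is nonnegative: for the probability weights [a ^+ 2], the mean of
[a ^+ 2] is [psum 4 l] and the mean of its square is [psum 6 l]. *)
Lemma psum4_sqr_le l : psum 2 l = 1 -> psum 4 l ^+ 2 <= psum 6 l.
Proof.
move=> l1; have : 0 <= \sum_(a <- l) a ^+ 2 * (a ^+ 2 - psum 4 l) ^+ 2.
  by apply: sumr_ge0 => a _; rewrite mulr_ge0 ?sqr_ge0.
have -> m : \sum_(a <- l) a ^+ 2 * (a ^+ 2 - m) ^+ 2
   = psum 6 l - 2 * m * psum 4 l + m ^+ 2 * psum 2 l.
  rewrite /psum !mulr_sumr -sumrB -big_split /=.
  by apply: eq_bigr => a _; ring.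
by rewrite l1; lra.
Qed.

(** When the squares of the coefficients add up to 1 and all equal t, the moments of
orders 2, 4, 6, 8 are the four values that multiply p1, p2, p3, p4 here. *)
Definition equal_weight_mean (p0 p1 p2 p3 p4 t : R) :=
  p0 + p1 + p2 * (3 - 2 * t) + p3 * (15 - 30 * t + 16 * t ^+ 2)
  + p4 * (105 - 420 * t + 588 * t ^+ 2 - 272 * t ^+ 3).

(** The mean of an even polynomial of degree eight is, but for the term in
[psum 4 l ^+ 2], an average of [equal_weight_mean] over the weights [a ^+ 2];
since p4 >= 0, [psum4_sqr_le] bounds that term by such an average too. So equal
coefficients are the worst case. *)
Lemma sgn_tail_moment (p0 p1 p2 p3 p4 beta B x : R) l :
  psum 2 l = 1 -> (forall a, a \in l -> a ^+ 2 <= beta) -> 0 < x -> 0 <= p4 ->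
  (forall y, 0 <= y ->
     0 <= p0 + p1 * y + p2 * y ^+ 2 + p3 * y ^+ 3 + p4 * y ^+ 4) ->
  (forall y, x ^+ 2 <= y ->
     1 <= p0 + p1 * y + p2 * y ^+ 2 + p3 * y ^+ 3 + p4 * y ^+ 4) ->
  (forall t, 0 <= t -> t <= beta -> equal_weight_mean p0 p1 p2 p3 p4 t <= B) ->
  sgn_tail l x <= B / 2.
Proof.
move=> l1 lb x0 p40 pge0 pge1 pB.
have pE s : p0 + p1 * s ^+ 2 + p2 * s ^+ 4 + p3 * s ^+ 6 + p4 * s ^+ 8 =
  p0 + p1 * s ^+ 2 + p2 * (s ^+ 2) ^+ 2 + p3 * (s ^+ 2) ^+ 3
     + p4 * (s ^+ 2) ^+ 4.
  by rewrite -!exprM.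
apply: (le_trans (@sgn_tail_two_sided _ _
  (fun s => p0 + p1 * s ^+ 2 + p2 * s ^+ 4 + p3 * s ^+ 6 + p4 * s ^+ 8)
  _ _ _ x0)).
- by move=> s; rewrite pE pge0 ?sqr_ge0.
- by move=> s xs; rewrite pE pge1 ?ler_pXn2r ?nnegrE// ltW// (lt_le_trans x0).
- by move=> s; ring.
rewrite ler_pM2r ?invr_gt0 ?ltr0n//.
rewrite sgn_mean_even_poly sgn_mean_pow2 sgn_mean_pow4 sgn_mean_pow6 sgn_mean_pow8.
rewrite l1 !expr1n !mulr1.
apply: (@le_trans _ _ (\sum_(a <- l) a ^+ 2 * equal_weight_mean p0 p1 p2 p3 p4 (a ^+ 2))).
  have -> : \sum_(a <- l) a ^+ 2 * equal_weight_mean p0 p1 p2 p3 p4 (a ^+ 2)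
    = (p0 + p1 + 3 * p2 + 15 * p3 + 105 * p4) * psum 2 l
      + (- 2 * p2 - 30 * p3 - 420 * p4) * psum 4 l
      + (16 * p3 + 588 * p4) * psum 6 l - 272 * p4 * psum 8 l.
    rewrite /psum !mulr_sumr -!big_split -sumrB /=.
    by apply: eq_bigr => a _; rewrite /equal_weight_mean; ring.
  rewrite l1; have := ler_wpM2l p40 (psum4_sqr_le l1); lra.
rewrite -[leRHS]mulr1 -l1 mulr_sumr big_seq [leRHS]big_seq.
apply: ler_sum => a al; rewrite mulrC ler_wpM2r ?sqr_ge0//.
by rewrite pB ?sqr_ge0// lb.
Qed.

Lemma chebyshev_sgn_tail l x : 0 < x -> sgn_tail l x <= psum 2 l / (2 * x ^+ 2).
Proof.
move=> x0; have x20 : 0 < x ^+ 2 by rewrite exprn_gt0.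
apply: (le_trans (@sgn_tail_two_sided _ _ (fun s => (x ^+ 2)^-1 * s ^+ 2) _ _ _ x0)).
- by move=> s; rewrite mulr_ge0 ?sqr_ge0// invr_ge0 ltW.
- move=> s xs; rewrite mulrC ler_pdivlMr// mul1r ler_pXn2r// nnegrE ltW//.
  exact: lt_le_trans xs.
- by move=> s; rewrite sqrrN.
rewrite sgn_meanZ sgn_mean_pow2 le_eqVlt; apply/orP; left; apply/eqP.
by field; rewrite gt_eqF.
Qed.

End SignAverages.

(** * Polynomial bounds for tails of sign sums *)

Section PolynomialBounds.
Variable R : realFieldType.
Implicit Types (l : seq R) (a x y : R).

(** The four left-hand sides are the Bernstein coefficients of the cubic on [0, b],
and the cubic is a convex combination of them. *)
Lemma cubic_le_bernstein (c0 c1 c2 c3 b B t : R) : 0 <= t -> t <= b -> 0 < b ->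
  c0 <= B -> c0 + c1 * b / 3 <= B ->
  c0 + 2 * c1 * b / 3 + c2 * b ^+ 2 / 3 <= B ->
  c0 + c1 * b + c2 * b ^+ 2 + c3 * b ^+ 3 <= B ->
  c0 + c1 * t + c2 * t ^+ 2 + c3 * t ^+ 3 <= B.
Proof.
move=> t0 tb b0 h0 h1 h2 h3; have b30 : 0 < b ^+ 3 by rewrite exprn_gt0.
rewrite -(ler_pM2r b30) -subr_ge0.
have -> : B * b ^+ 3 - (c0 + c1 * t + c2 * t ^+ 2 + c3 * t ^+ 3) * b ^+ 3
  = (b - t) ^+ 3 * (B - c0) + 3 * (t * (b - t) ^+ 2) * (B - (c0 + c1 * b / 3))
    + 3 * (t ^+ 2 * (b - t)) * (B - (c0 + 2 * c1 * b / 3 + c2 * b ^+ 2 / 3))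
    + t ^+ 3 * (B - (c0 + c1 * b + c2 * b ^+ 2 + c3 * b ^+ 3)) by field.
have bt : 0 <= b - t by rewrite subr_ge0.
by rewrite !addr_ge0// !mulr_ge0 ?exprn_ge0 ?subr_ge0.
Qed.

(** The majorant of the indicator of y >= X is the quartic with the value 1 at X, a
double zero at z and double contact with 1 at w, namely
1 + L (y - X) (y - w)^2 (1 + k (y - z)). It is at least 1 beyond X. In terms of
u = (y - z) / (X - z) and v = (y - z) / (w - z) it is
1 - (1 - u) (1 - v)^2 (1 + u + 2 v) = v^2 (2 - v^2) + (1 - v)^2 (u + v)^2,
which is nonnegative as long as v is at most 1 in absolute value. The last four
hypotheses bound the Bernstein coefficients of its mean at equal weights. *)
Lemma sgn_tail_hermite l x (X z w L k beta B : R) :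
  psum 2 l = 1 -> (forall a, a \in l -> a ^+ 2 <= beta) -> 0 < x -> X <= x ^+ 2 ->
  0 <= z -> z < X -> X < w -> 2 * z <= w -> 0 < beta ->
  L * ((X - z) * (w - z) ^+ 2) = 1 ->
  k * ((X - z) * (w - z)) = (w - z) + 2 * (X - z) ->
  let p0 := 1 - L * (1 - k * z) * (w ^+ 2 * X) in
  let p1 := L * ((1 - k * z) * (w ^+ 2 + 2 * w * X) - k * (w ^+ 2 * X)) in
  let p2 := L * (k * (w ^+ 2 + 2 * w * X) - (1 - k * z) * (X + 2 * w)) in
  let p3 := L * (1 - k * z - k * (X + 2 * w)) in
  let p4 := L * k in
  let c0 := p0 + p1 + 3 * p2 + 15 * p3 + 105 * p4 in
  let c1 := - (2 * p2 + 30 * p3 + 420 * p4) in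
  let c2 := 16 * p3 + 588 * p4 in
  let c3 := - (272 * p4) in
  c0 <= B -> c0 + c1 * beta / 3 <= B ->
  c0 + 2 * c1 * beta / 3 + c2 * beta ^+ 2 / 3 <= B ->
  c0 + c1 * beta + c2 * beta ^+ 2 + c3 * beta ^+ 3 <= B ->
  sgn_tail l x <= B / 2.
Proof.
move=> l1 lb x0 Xx z0 zX Xw zw b0 LE kE p0 p1 p2 p3 p4 c0 c1 c2 c3 h0 h1 h2 h3.
have A0 : 0 < X - z by rewrite subr_gt0.
have B0 : 0 < w - z by rewrite subr_gt0 (lt_trans zX).
have L0 : 0 < L.
  by rewrite -(@pmulr_lgt0 _ ((X - z) * (w - z) ^+ 2)) ?LE// mulr_gt0// exprn_gt0.
have k0 : 0 < k.
  rewrite -(@pmulr_lgt0 _ ((X - z) * (w - z))) ?kE ?mulr_gt0//; lra.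
have pE y : p0 + p1 * y + p2 * y ^+ 2 + p3 * y ^+ 3 + p4 * y ^+ 4 =
    1 + L * ((y - X) * (y - w) ^+ 2 * (1 + k * (y - z))).
  by rewrite /p0 /p1 /p2 /p3 /p4; ring.
have pge1 y : X <= y ->
    1 <= p0 + p1 * y + p2 * y ^+ 2 + p3 * y ^+ 3 + p4 * y ^+ 4.
  move=> Xy; rewrite pE lerDl mulr_ge0 ?(ltW L0)// mulr_ge0//.
    by rewrite mulr_ge0 ?sqr_ge0 ?subr_ge0.
  by rewrite addr_ge0// mulr_ge0 ?(ltW k0)// subr_ge0 (le_trans (ltW zX)).
apply: (@sgn_tail_moment _ p0 p1 p2 p3 p4 beta) => //.
- by rewrite mulr_ge0 ?ltW.
- move=> y y0; have [/pge1|yX] := leP X y; first exact: le_trans ler01.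
  pose u := (y - z) / (X - z); pose v := (y - z) / (w - z).
  have uE : y - z = u * (X - z) by rewrite /u divfK ?gt_eqF.
  have vE : y - z = v * (w - z) by rewrite /v divfK ?gt_eqF.
  have v1 : -1 <= v by rewrite /v ler_pdivlMr//; lra.
  have v2 : v <= 1 by rewrite /v ler_pdivrMr//; lra.
  have kv : k * (y - z) = u + 2 * v.
    have nA : X - z != 0 by rewrite gt_eqF.
    have nB : w - z != 0 by rewrite gt_eqF.
    have -> : k = ((w - z) + 2 * (X - z)) / ((X - z) * (w - z)).
      by rewrite -kE mulfK// mulf_neq0.
    by rewrite /u /v; field; rewrite nA nB.
  rewrite pE kv.
  have -> : y - X = - ((1 - u) * (X - z)) by rewrite mulrBl -uE; ring.
  have -> : y - w = - ((1 - v) * (w - z)) by rewrite mulrBl -vE; ring.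
  have -> : 1 + L * (- ((1 - u) * (X - z)) * (- ((1 - v) * (w - z))) ^+ 2
      * (1 + (u + 2 * v)))
    = 1 - (L * ((X - z) * (w - z) ^+ 2)) * ((1 - u) * (1 - v) ^+ 2 * (1 + (u + 2 * v))).
    ring.
  rewrite LE.
  have -> : 1 - 1 * ((1 - u) * (1 - v) ^+ 2 * (1 + (u + 2 * v)))
    = v ^+ 2 * (1 + (1 - v) * (1 + v)) + (1 - v) ^+ 2 * (u + v) ^+ 2 by ring.
  apply: addr_ge0; rewrite mulr_ge0 ?sqr_ge0// addr_ge0// mulr_ge0//; lra.
- by move=> y /(le_trans Xx)/pge1.
- move=> t t0 tb.
  have -> : equal_weight_mean p0 p1 p2 p3 p4 t = c0 + c1 * t + c2 * t ^+ 2 + c3 * t ^+ 3.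
    by rewrite /equal_weight_mean /c0 /c1 /c2 /c3; ring.
  exact: (cubic_le_bernstein t0 tb b0).
Qed.

(** If no coefficient exceeds 1/2 in absolute value, the majorant
y ((y - 13/2)^2 + 23/4) / 36 = 1 + (y - 1) (y - 6)^2 / 36 of the indicator of
y >= 1 has mean at most 2/3. Otherwise condition on the sign of a coefficient
b > 1/2: one conditional tail is at most 1/2 by symmetry, the other at most
(1 - b^2) / (2 (1 + b)^2) < 1/6 by Chebyshev. *)
Lemma sgn_tail_le_third l x : psum 2 l = 1 -> 1 < x -> sgn_tail l x <= 1 / 3.
Proof.
move=> l1 x1; have x0 : 0 < x by rewrite (lt_trans ltr01).
have [/hasP[a al]|/hasPn H] := boolP (has (fun a => 1 / 2 < `|a|) l); last first.
  have -> : 1 / 3 = (2 / 3) / 2 :> R by field.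
  apply: (@sgn_tail_moment _ 0 (48 / 36) (- 13 / 36) (1 / 36) 0 (1 / 4)) => //.
  - move=> a al; have := H a al; rewrite -leNgt => ha.
    rewrite -real_normK ?num_real//.
    have -> : 1 / 4 = (1 / 2) ^+ 2 :> R by field.
    by rewrite ler_pXn2r// nnegrE// divr_ge0.
  - move=> y y0; rewrite mul0r.
    have -> : 0 + 48 / 36 * y + - 13 / 36 * y ^+ 2 + 1 / 36 * y ^+ 3 + 0 =
      y * ((y - 13 / 2) ^+ 2 + 23 / 4) / 36 by field.
    by rewrite divr_ge0// mulr_ge0// addr_ge0 ?sqr_ge0// divr_ge0.
  - move=> y xy; have y1 : 1 <= y.
      by apply: le_trans xy; rewrite expr_ge1 ?ltW.
    rewrite mul0r -subr_ge0.
    have -> : 0 + 48 / 36 * y + - 13 / 36 * y ^+ 2 + 1 / 36 * y ^+ 3 + 0 - 1 =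
      (y - 1) * (y - 6) ^+ 2 / 36 by field.
    by rewrite divr_ge0// mulr_ge0 ?sqr_ge0 ?subr_ge0.
  - move=> t t0 tb; rewrite /equal_weight_mean.
    have : 0 <= t * (1 / 4 - t) by rewrite mulr_ge0// subr_ge0.
    by lra.
move=> ha; rewrite /sgn_tail (perm_sgn_mean _ (perm_to_rem al)).
rewrite -/(sgn_tail _ _) -sgn_tail_norm sgn_tail_cons.
set b := `|a|; set l' := rem a l.
have bl : b ^+ 2 + psum 2 l' = 1.
  by rewrite -l1 (perm_psum _ (perm_to_rem al)) psum_cons real_normK ?num_real.
have b1 : b <= 1.
  have : b ^+ 2 <= 1 by have := psum2_ge0 l'; lra.
  by rewrite expr_le1// /b normr_ge0.
have h1 : sgn_tail l' (x - b) <= 1 / 2.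
  by apply: sgn_tail_le_half; rewrite subr_gt0 (le_lt_trans b1).
have b0 : 1 / 2 < b by [].
have h2 : sgn_tail l' (x + b) <= 1 / 6.
  apply: (@le_trans _ _ (sgn_tail l' (1 + b))).
    by apply: sgn_tail_anti; rewrite lerD2r ltW.
  have p0 : 0 < 1 + b by move: b0; lra.
  apply: (le_trans (chebyshev_sgn_tail _ p0)).
  rewrite ler_pdivrMr ?mulr_gt0 ?exprn_gt0//.
  have -> : psum 2 l' = (1 - b) * (1 + b) by move: bl; lra.
  have : 0 <= (b - 1 / 2) * (1 + b) by rewrite mulr_ge0//; move: b0; lra.
  by lra.
by move: h1 h2; lra.
Qed.

End PolynomialBounds.

(** * The Gaussian tail and its derivative *)

Section GaussianTail.
Variable R : realType.
Implicit Types x y : R.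
Notation mu := (@lebesgue_measure R).

Lemma nondecreasing_is_derive (f f' : R -> R) (a b : R) : a <= b ->
  (forall x, a <= x <= b -> is_derive x 1 f (f' x)) ->
  (forall x, a < x < b -> 0 <= f' x) -> f a <= f b.
Proof.
move=> ab df f'0.
apply: (@ger0_derive1_le_cc _ f a b) => //.
- move=> x; rewrite in_itv /= => /andP[ax xb].
  by have [] := df x; rewrite ?(ltW ax) ?(ltW xb).
- move=> x; rewrite in_itv /= => xab; rewrite derive1E.
  have [ax xb] := andP xab.
  have [_ ->] : is_derive x 1 f (f' x) by apply: df; rewrite ?(ltW ax) ?(ltW xb).
  exact: f'0.
- apply: derivable_within_continuous => x; rewrite in_itv /= => xab.
  by have [] := df x xab.
- by rewrite in_itv /= lexx.
- by rewrite in_itv /= lexx andbT.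
Qed.

Lemma phi_continuous : continuous (@phi R).
Proof.
have -> : @phi R = normal_pdf 0 1 by apply/funext => x; rewrite phiE.
exact/continuous_normal_pdf/oner_neq0.
Qed.

Lemma phi_integrable (A : set R) : measurable A ->
  mu.-integrable A (EFin \o @phi R).
Proof.
move=> mA; apply: (@integrableS _ _ _ mu setT) => //.
have -> : EFin \o @phi R = (fun x => (normal_pdf 0 1 x)%:E).
  by apply/funext => x /=; rewrite phiE.
exact: integrable_normal_pdf.
Qed.

Lemma integral_phi : \int[mu]_x phi x = 1.
Proof.
rewrite /Rintegral -[RHS]/(fine 1%E); congr fine.
rewrite -(@integral_normal_pdf R 0 1); apply: eq_integral => x _.
by rewrite phiE.
Qed.

Lemma Phibar_cdf x : Phibar x = 1 - \int[mu]_(u in `]-oo, x]) phi u.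
Proof.
rewrite PhibarE -integral_phi -set_itvNyy Rintegral_itvB//; last first.
  exact: phi_integrable.
by rewrite Rintegral_itv_obnd_cbnd//; exact: phi_integrable.
Qed.

Global Instance is_derive_Phibar x : is_derive x 1 (@Phibar R) (- phi x).
Proof.
have -> : @Phibar R = cst 1 - (fun x => \int[mu]_(u in `]-oo, x]) phi u).
  by apply/funext => y; rewrite Phibar_cdf.
have [dF F'] : derivable (fun x => \int[mu]_(u in `]-oo, x]) phi u) x 1 /\
    (fun x => \int[mu]_(u in `]-oo, x]) phi u)^`()%classic x = phi x.
  apply: (@continuous_FTC1 R (@phi R) -oo%O x (x + 1)).
  - by rewrite ltrDl.
  - exact: phi_integrable.
  - by rewrite ltNyr.
  - exact: phi_continuous.
rewrite -[- phi x]add0r; apply: is_deriveB.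
split; first exact: dF.
by rewrite -derive1E; exact: F'.
Qed.

Lemma phi_gt0 x : 0 < phi x.
Proof.
by rewrite /phi divr_gt0 ?expR_gt0// sqrtr_gt0 mulr_gt0 ?ltr0n ?pi_gt0.
Qed.

Lemma phi_phi0 x : phi x = phi 0 * expR (- (x ^+ 2 / 2)).
Proof.
by rewrite /phi expr0n /= oppr0 mul0r expR0 mul1r mulrC mulNr.
Qed.

Global Instance is_derive_phi x : is_derive x 1 (@phi R) (- x * phi x).
Proof.
have -> : @phi R = (fun x => phi 0 * expR (- (x ^+ 2 / 2))).
  by apply/funext => y; rewrite -phi_phi0.
apply: is_derive_eq.
by rewrite /GRing.scale /=; field.
Qed.

Lemma Phibar0 : Phibar (0 : R) = 1 / 2.
Proof.
have := integral_phi; rewrite /Rintegral (@ge0_symfun_integralT _ (@phi R)).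
- rewrite -set_itvcy.
  have -> : (\int[mu]_(x in `[0%R, +oo[) (phi x)%:E)%E = (Phibar (0 : R))%:E.
    rewrite PhibarE /Rintegral fineK//; apply: integrable_fin_num => //.
    exact: phi_integrable.
  by rewrite -EFinM /=; lra.
- by move=> x; exact/ltW/phi_gt0.
- exact: phi_continuous.
- by move=> x; rewrite /= /phi sqrrN.
Qed.

End GaussianTail.

(** * Alternating expansions of the Gaussian tail *)

Section AlternatingExpansions.
Variable R : realType.
Implicit Types x y : R.

Definition exp_partial (n : nat) y : R := \sum_(k < n) (-1) ^+ k * y ^+ k / k`!%:R.

Definition gauss_partial (n : nat) x : R :=
  \sum_(k < n) (-1) ^+ k * x ^+ k.*2.+1 / (2 ^+ k * k`!%:R * k.*2.+1%:R).

Global Instance is_derive_pow n x :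
  is_derive x 1 (fun z : R => z ^+ n.+1) (n.+1%:R * x ^+ n).
Proof.
elim: n => [|n IH].
  by rewrite expr0 mulr1; apply: is_derive_id.
have -> : (fun z : R => z ^+ n.+2) = (fun z => z * z ^+ n.+1).
  by apply/funext => z; rewrite exprS.
apply: is_derive_eq.
by rewrite /GRing.scale /= -[n.+2]addn1 natrD exprS; ring.
Qed.

Lemma is_derive_exp_partial n y :
  is_derive y 1 (exp_partial n.+1) (- exp_partial n y).
Proof.
elim: n => [|n IH].
  have -> : exp_partial 1 = cst 1.
    by apply/funext => z; rewrite /exp_partial big_ord1 expr0 fact0 divr1 expr0 mul1r.
  by rewrite /exp_partial big_ord0 oppr0; apply: is_derive_cst.
have -> : exp_partial n.+2 = exp_partial n.+1 + (fun z => (-1) ^+ n.+1 * z ^+ n.+1 / n.+1`!%:R).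
  by apply/funext => z; rewrite /exp_partial big_ord_recr.
rewrite {2}/exp_partial big_ord_recr /= opprD.
apply: is_deriveD; apply: is_derive_eq.
rewrite /GRing.scale /= factS natrM exprS; field.
by rewrite nat1r !pnatr_eq0 -lt0n fact_gt0.
Qed.

Lemma is_derive_gauss_partial n x :
  is_derive x 1 (gauss_partial n) (exp_partial n (x ^+ 2 / 2)).
Proof.
elim: n => [|n IH].
  have -> : gauss_partial 0 = cst 0.
    by apply/funext => z; rewrite /gauss_partial big_ord0.
  by rewrite /exp_partial big_ord0; apply: is_derive_cst.
have -> : gauss_partial n.+1 = gauss_partial n +
    (fun z => (-1) ^+ n * z ^+ n.*2.+1 / (2 ^+ n * n`!%:R * n.*2.+1%:R)).
  by apply/funext => z; rewrite /gauss_partial big_ord_recr.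
rewrite /exp_partial big_ord_recr /=.
apply: is_deriveD; apply: is_derive_eq.
rewrite /GRing.scale /= expr_div_n -exprM mul2n.
have n0 : (n.*2.+1%:R : R) != 0 by rewrite pnatr_eq0.
have f0 : (n`!%:R : R) != 0 by rewrite pnatr_eq0 -lt0n fact_gt0.
have p0 : (2 : R) ^+ n != 0 by rewrite expf_neq0 ?pnatr_eq0.
move: (n.*2.+1%:R : R) n0 => N n0.
field.
by rewrite ?n0 f0 p0.
Qed.

(** The derivative of a partial sum is minus the preceding one, so the sign of the
error alternates, by induction and integration from 0. *)
Lemma exp_partial_alternating n y : 0 <= y ->
  0 <= (-1) ^+ n * (expR (- y) - exp_partial n y).
Proof.
elim: n y => [|n IH] y y0.
  by rewrite /exp_partial big_ord0 subr0 expr0 mul1r expR_ge0.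
pose h : R -> R := fun z => (-1) ^+ n.+1 * (expR (- z) - exp_partial n.+1 z).
have h0 : h 0 = 0.
  rewrite /h oppr0 expR0 /exp_partial big_ord_recl big1 ?addr0.
    by rewrite expr0 fact0 divr1 mul1r subrr mulr0.
  by move=> i _; rewrite expr0n mulr0 mul0r.
suff: h 0 <= h y by rewrite h0.
apply: (@nondecreasing_is_derive _ h
  (fun z => (-1) ^+ n * (expR (- z) - exp_partial n z))).
- exact: y0.
- move=> x _; have := is_derive_exp_partial n x => dE.
  apply: is_derive_eq.
  rewrite /GRing.scale /=; rewrite exprS; ring.
- by move=> x /andP[x0 _]; apply/IH/ltW.
Qed.

(** [gauss_partial] integrates the partial sums of exp (- x^2 / 2) term by term, and
the tail is 1/2 at the origin. *)
Lemma Phibar_alternating n x : 0 <= x ->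
  0 <= (-1) ^+ n * (1 / 2 - phi 0 * gauss_partial n x - Phibar x).
Proof.
move=> x0; pose h : R -> R := fun z => (-1) ^+ n * (1 / 2 - phi 0 * gauss_partial n z - Phibar z).
have h0 : h 0 = 0.
  rewrite /h Phibar0 /gauss_partial big1 ?mulr0 ?subr0 ?subrr ?mulr0//.
  by move=> i _; rewrite expr0n /= mulr0 mul0r.
have dh (z : R) : is_derive z 1 h
    ((-1) ^+ n * (phi 0 * (expR (- (z ^+ 2 / 2)) - exp_partial n (z ^+ 2 / 2)))).
  have := is_derive_gauss_partial n z => dE.
  apply: is_derive_eq.
  by rewrite /GRing.scale /= (phi_phi0 z); ring.
have h'0 (z : R) : 0 < z < x -> 0 <= (-1) ^+ n *
    (phi 0 * (expR (- (z ^+ 2 / 2)) - exp_partial n (z ^+ 2 / 2))).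
  move=> _; rewrite mulrCA mulr_ge0 ?(ltW (phi_gt0 _))//.
  by apply: exp_partial_alternating; rewrite divr_ge0 ?sqr_ge0.
have := nondecreasing_is_derive x0 (fun z _ => dh z) h'0.
by rewrite h0.
Qed.

End AlternatingExpansions.

(** * The Gaussian tail at infinity and Mills ratio bounds *)

Section MillsRatio.
Variable R : realType.
Implicit Types x y a : R.

Lemma is_derive_div (f g : R -> R) x df dg : g x != 0 ->
  is_derive x 1 f df -> is_derive x 1 g dg ->
  is_derive x 1 (fun z => f z / g z) ((df * g x - f x * dg) / g x ^+ 2).
Proof.
move=> gx df' dg'; have dV := is_deriveV gx dg'.
have D := is_deriveM df' dV; apply: is_derive_eq.
by rewrite /GRing.scale /=; field.
Qed.

Lemma Phibar_ge0 x : 0 <= Phibar x.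
Proof. by rewrite fine_ge0. Qed.

(** The identity as a random variable on the line: under the standard normal law its
distribution tails are those of [Phibar]. *)
Definition gauss_id : measurableTypeR R -> R := idfun.

HB.instance Definition _ :=
  @isMeasurableFun.Build _ _ _ _ gauss_id (@measurable_id _ _ setT).

Lemma Phibar_small a e : 0 < e -> exists2 b : R, a <= b & Phibar b < e.
Proof.
move=> e0; pose X : {RV (normal_prob (0 : R) 1) >-> R} := gauss_id.
have /fine_cvgP[_] := cvg_ccdfy0 X.
move=> /cvgrPdist_lt/(_ e e0) H.
have [r [ar re]] : exists r, a <= r /\ `|0 - (fine \o ccdf X) r| < e.
  near (+oo%R : set_system R) => r; exists r; split.
    by near: r; apply: nbhs_pinfty_ge; rewrite num_real.
  by near: r.
exists (r + 1); first by rewrite (le_trans ar)// lerDl.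
apply: le_lt_trans re; rewrite sub0r normrN /= ger0_norm ?fine_ge0//.
rewrite /ccdf /distribution /pushforward preimage_id /Phibar.
apply: fine_le; rewrite ?fin_num_measure//.
rewrite le_measure ?inE//.
by apply: subset_itvr; rewrite bnd_simp ltrDl.
Unshelve. all: by end_near. Qed.

Lemma Phibar_anti x y : x <= y -> Phibar y <= Phibar x.
Proof.
move=> xy; rewrite -lerN2.
apply: (@nondecreasing_is_derive R (fun z => - Phibar z) (fun z => phi z)) => //.
  by move=> z _; apply: is_derive_eq; rewrite opprK.
by move=> z _; exact/ltW/phi_gt0.
Qed.

Lemma phi_anti x y : 0 <= x -> x <= y -> phi y <= phi x.
Proof.
move=> x0 xy; rewrite (phi_phi0 x) (phi_phi0 y) ler_pM2l ?phi_gt0//.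
rewrite ler_expR lerN2 ler_pM2r ?invr_gt0//.
by rewrite ler_pXn2r// nnegrE// (le_trans x0).
Qed.

Lemma phi_small a e : 0 < e -> exists2 b : R, a <= b & phi b <= e.
Proof.
move=> e0; exists (Num.max 0 (Num.max a (phi 0 / e))).
  by rewrite !le_max lexx orbT.
set b := Num.max _ _.
have b0 : 0 <= b by rewrite le_max lexx.
have be : phi 0 / e <= b by rewrite !le_max lexx !orbT.
have eb : b <= expR (b ^+ 2 / 2).
  apply: le_trans (expR_ge1Dx _); have := sqr_ge0 (b - 1); lra.
rewrite phi_phi0 expRN -ler_pdivlMr ?invr_gt0 ?expR_gt0// invrK.
rewrite -ler_pdivrMl// mulrC; exact: le_trans eb.
Qed.

(** phi f - Phibar has derivative phi (f' - x f + 1) <= 0, and it is at least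
- Phibar, which tends to 0 at infinity. *)
Lemma Phibar_le_of_ode (f f' : R -> R) a :
  (forall x, a <= x -> is_derive x 1 f (f' x)) ->
  (forall x, a <= x -> f' x - x * f x <= - 1) ->
  (forall x, a <= x -> 0 <= f x) -> Phibar a <= phi a * f a.
Proof.
move=> df f'le f0; apply/ler_addgt0Pr => e e0.
have [b ab be] := Phibar_small a e0.
have dg x : a <= x -> is_derive x 1 (fun z => Phibar z - phi z * f z)
    (phi x * (x * f x - 1 - f' x)).
  by move=> ax; have := df x ax => dfx; apply: is_derive_eq;
    rewrite /GRing.scale /=; ring.
have : Phibar a - phi a * f a <= Phibar b - phi b * f b.
  apply: (nondecreasing_is_derive ab (fun z h => dg z (proj1 (andP h)))).
  move=> x /andP[ax _].
  rewrite mulr_ge0 ?(ltW (phi_gt0 _))//.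
  by have := f'le _ (ltW ax); lra.
have : 0 <= phi b * f b by rewrite mulr_ge0 ?(ltW (phi_gt0 _))// f0.
by move: be; lra.
Qed.

(** phi f - Phibar is nondecreasing here, and at most phi f <= phi, which tends to 0
at infinity. *)
Lemma Phibar_ge_of_ode (f f' : R -> R) a :
  (forall x, a <= x -> is_derive x 1 f (f' x)) ->
  (forall x, a <= x -> - 1 <= f' x - x * f x) ->
  (forall x, a <= x -> f x <= 1) -> phi a * f a <= Phibar a.
Proof.
move=> df f'le f1; apply/ler_addgt0Pr => e e0.
have [b ab be] := phi_small a e0.
have dg x : a <= x -> is_derive x 1 (fun z => phi z * f z - Phibar z)
    (phi x * (1 + f' x - x * f x)).
  by move=> ax; have := df x ax => dfx; apply: is_derive_eq;
    rewrite /GRing.scale /=; ring.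
have : phi a * f a - Phibar a <= phi b * f b - Phibar b.
  apply: (nondecreasing_is_derive ab (fun z h => dg z (proj1 (andP h)))).
  move=> x /andP[ax _].
  rewrite mulr_ge0 ?(ltW (phi_gt0 _))//.
  by have := f'le _ (ltW ax); lra.
have : phi b * f b <= phi b * 1 by rewrite ler_pM2l ?phi_gt0// f1.
by move: be (Phibar_ge0 b); lra.
Qed.

Lemma Phibar_le_phi_div x : 0 < x -> Phibar x <= phi x / x.
Proof.
move=> x0; apply: (@Phibar_le_of_ode (fun z => z^-1) (fun z => - z ^- 2)).
- move=> z xz; have z0 : z != 0 by rewrite gt_eqF// (lt_le_trans x0).
  have := @is_deriveV R id z 1 1 z0 (is_derive_id _ _).
  by rewrite /GRing.scale /= mulr1.
- move=> z xz; have z0 : z != 0 by rewrite gt_eqF// (lt_le_trans x0).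
  by rewrite mulfV// lerBlDr addNr oppr_le0 invr_ge0 sqr_ge0.
- by move=> z xz; rewrite invr_ge0 (le_trans (ltW x0)).
Qed.

Lemma Phibar_gt0 x : 0 < Phibar x.
Proof.
wlog x0 : x / 0 < x.
  move=> H; have [|x0] := ltP 0 x; first exact: H.
  by apply: lt_le_trans (H 1 ltr01) (Phibar_anti _); rewrite (le_trans x0).
apply: (@lt_le_trans _ _ (phi x * (x / (x ^+ 2 + 1)))).
  by rewrite mulr_gt0 ?phi_gt0// divr_gt0// ltr_wpDl// sqr_ge0.
have q0 (z : R) : z ^+ 2 + 1 != 0 by rewrite gt_eqF// ltr_wpDl// sqr_ge0.
apply: (@Phibar_ge_of_ode (fun z => z / (z ^+ 2 + 1))
  (fun z => (1 - z ^+ 2) / (z ^+ 2 + 1) ^+ 2)).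
- move=> z _; have qz := q0 z.
  have dq : is_derive z 1 (fun z : R => z ^+ 2 + 1) (2 * z).
    by apply: is_derive_eq; rewrite /GRing.scale /=; ring.
  have D := @is_derive_div id (fun z => z ^+ 2 + 1) z _ _ qz (is_derive_id _ _) dq.
  by apply: is_derive_eq; congr (_ / _); ring.
- move=> z _; rewrite -subr_ge0.
  have -> : (1 - z ^+ 2) / (z ^+ 2 + 1) ^+ 2 - z * (z / (z ^+ 2 + 1)) - -1
    = 2 / (z ^+ 2 + 1) ^+ 2 by field.
  by rewrite divr_ge0// sqr_ge0.
- move=> z _; rewrite ler_pdivrMr ?mul1r; last by rewrite ltr_wpDl// sqr_ge0.
  by have := sqr_ge0 (z - 1); have := sqr_ge0 (z + 1); lra.
Qed.

End MillsRatio.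

(** * Splitting one sign off a Gaussian tail *)

Section GaussianSplit.
Variable R : realType.
Implicit Types x y a t : R.

(** The right side is 2 artanh t. Both sides vanish at 0 and the derivatives differ
by 8 t^4 / (9 (1 - t^2) (1 - t^2 / 3)^2). *)
Lemma artanh_ge t : 0 <= t -> t < 1 ->
  2 * (t / (1 - t ^+ 2 / 3)) <= ln (1 + t) - ln (1 - t).
Proof.
move=> t0 t1; rewrite -subr_ge0.
pose g : R -> R := fun z => ln (1 + z) - ln (1 - z) - 2 * (z / (1 - z ^+ 2 / 3)).
pose g' : R -> R := fun z =>
  (1 + z)^-1 + (1 - z)^-1 - 2 * ((1 + z ^+ 2 / 3) / (1 - z ^+ 2 / 3) ^+ 2).
have sq (z : R) : 0 <= z <= t -> 0 <= z ^+ 2 /\ z ^+ 2 < 1.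
  move=> /andP[z0 zt]; rewrite sqr_ge0 expr_lt1//; split => //.
  exact: le_lt_trans t1.
have dg (z : R) : 0 <= z <= t -> is_derive z 1 g (g' z).
  move=> zt; have [z0 z1] := sq z zt; case/andP: zt => zge0 zlet.
  have p1 : 0 < 1 + z by rewrite ltr_pwDl.
  have p2 : 0 < 1 - z by rewrite subr_gt0 (le_lt_trans zlet).
  have p3 : 1 - z ^+ 2 / 3 != 0 by rewrite gt_eqF//; lra.
  have d1 : is_derive z 1 (fun y : R => ln (1 + y)) ((1 + z)^-1).
    have dl := @is_derive1_ln R _ p1.
    have da : is_derive z 1 (fun y : R => 1 + y) 1.
      by apply: is_derive_eq; rewrite /GRing.scale /=; ring.
    by apply: (is_derive_eq (@is_derive1_comp _ _ (fun y => 1 + y) _ _ _ dl da)); rewrite mulr1.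
  have d2 : is_derive z 1 (fun y : R => ln (1 - y)) (- (1 - z)^-1).
    have dl := @is_derive1_ln R _ p2.
    have da : is_derive z 1 (fun y : R => 1 - y) (-1).
      by apply: is_derive_eq; rewrite /GRing.scale /=; ring.
    by apply: (is_derive_eq (@is_derive1_comp _ _ (fun y => 1 - y) _ _ _ dl da)); rewrite mulrN1.
  have dq : is_derive z 1 (fun y : R => 1 - y ^+ 2 / 3) (- (2 * z / 3)).
    by apply: is_derive_eq; rewrite /GRing.scale /=; field.
  have D := @is_derive_div _ id (fun y => 1 - y ^+ 2 / 3) z _ _ p3
    (is_derive_id _ _) dq.
  apply: is_derive_eq; rewrite /g' opprK /GRing.scale /=; congr (_ - 2 * _).
  by congr (_ / _); field.
have g0 : g 0 = 0 by rewrite /g addr0 subr0 ln1 mul0r mulr0 !subr0.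
have g'0 (z : R) : 0 < z < t -> 0 <= g' z.
  move=> /andP[z0 zt]; have [] := sq z; first by rewrite !ltW.
  move: z0 zt; rewrite /g' => z0 zt s0 s1.
  have p1 : 1 + z != 0 by rewrite gt_eqF// ltr_pwDl// ltW.
  have p2 : 1 - z != 0 by rewrite gt_eqF// subr_gt0 (lt_trans zt).
  have p3 : 1 - z ^+ 2 / 3 != 0 by rewrite gt_eqF//; lra.
  have -> : (1 + z)^-1 + (1 - z)^-1 - 2 * ((1 + z ^+ 2 / 3) / (1 - z ^+ 2 / 3) ^+ 2)
    = 8 * (z ^+ 2) ^+ 2 / (9 * ((1 - z ^+ 2) * (1 - z ^+ 2 / 3) ^+ 2)).
    field; rewrite p1 p2 /=.
    have -> : 3 - z ^+ 2 = 3 * (1 - z ^+ 2 / 3) by field.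
    by rewrite mulf_neq0//= gt_eqF// subr_gt0.
  have q0 : 0 <= 1 - z ^+ 2 by rewrite subr_ge0 ltW.
  apply: divr_ge0; first by rewrite mulr_ge0 ?sqr_ge0.
  by apply: mulr_ge0 => //; rewrite mulr_ge0 ?sqr_ge0.
by have := nondecreasing_is_derive t0 dg g'0; rewrite g0.
Qed.

(** For t = a x >= 1 the left side is nonpositive. Otherwise a^2 <= t^2 / 3, so that
the exponent t / (1 - a^2) is at most t / (1 - t^2 / 3), and [artanh_ge] applies. *)
Lemma split_weight_le x a : 0 <= x -> 3 <= x ^+ 2 -> 0 <= a -> a < 1 ->
  (1 - a * x) * expR (a * x / (1 - a ^+ 2)) <=
  (1 + a * x) * expR (- (a * x / (1 - a ^+ 2))).
Proof.
move=> x0 x3 a0 a1; set t := a * x.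
have t0 : 0 <= t by rewrite mulr_ge0.
have s0 : 0 < 1 - a ^+ 2 by rewrite subr_gt0 expr_lt1.
have [t1|t1] := leP 1 t.
  apply: (@le_trans _ _ 0).
    by rewrite mulr_le0_ge0 ?expR_ge0// subr_le0.
  by rewrite mulr_ge0 ?expR_ge0// addr_ge0.
have at3 : a ^+ 2 <= t ^+ 2 / 3.
  by rewrite /t exprMn ler_pdivlMr// ler_wpM2l ?sqr_ge0.
have t21 : t ^+ 2 < 1 by rewrite expr_lt1.
have q0 : 0 < 1 - t ^+ 2 / 3 by lra.
set w := t / _; have wt : 2 * w <= ln (1 + t) - ln (1 - t).
  apply: le_trans (artanh_ge t0 t1); rewrite ler_pM2l// /w.
  by rewrite ler_wpM2l// lef_pV2 ?posrE// lerB.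
have p1 : 0 < 1 + t by rewrite ltr_pwDl.
have p2 : 0 < 1 - t by rewrite subr_gt0.
rewrite -{1}(lnK (x := 1 - t)) ?posrE// -{1}(lnK (x := 1 + t)) ?posrE//.
by rewrite -!expRD ler_expR; lra.
Qed.

(** Equality holds at a = 0, and the derivative in a of the left side is
((1 - a x) phi ((x - a) / s) - (1 + a x) phi ((x + a) / s)) / s^3 with
s = sqrt (1 - a^2). The two densities are a common factor times
exp (a x / s^2) and exp (- a x / s^2), so [split_weight_le] gives its sign. *)
Lemma Phibar_split_le x a : 0 <= x -> 3 <= x ^+ 2 -> 0 <= a -> a < 1 ->
  Phibar ((x - a) / Num.sqrt (1 - a ^+ 2)) + Phibar ((x + a) / Num.sqrt (1 - a ^+ 2))
  <= 2 * Phibar x.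
Proof.
move=> x0 x3 a0 a1.
pose s : R -> R := fun b => Num.sqrt (1 - b ^+ 2).
pose D : R -> R := fun b => - (Phibar ((x - b) / s b) + Phibar ((x + b) / s b)).
pose D' : R -> R := fun b =>
  ((1 + b * x) * phi ((x + b) / s b) - (1 - b * x) * phi ((x - b) / s b)) / s b ^+ 3.
have sgt0 (b : R) : 0 <= b <= a -> 0 < 1 - b ^+ 2.
  by case/andP=> b0 ba; rewrite subr_gt0 expr_lt1// (le_lt_trans ba).
have dD (b : R) : 0 <= b <= a -> is_derive b 1 D (D' b).
  move=> ba; have s2 := sgt0 b ba.
  have s0 : 0 < s b by rewrite sqrtr_gt0.
  have sn : s b != 0 by rewrite gt_eqF.
  have sE : s b ^+ 2 = 1 - b ^+ 2 by rewrite sqr_sqrtr ?ltW.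
  have ds : is_derive b 1 s (- b / s b).
    have dq := @is_derive1_sqrt R _ s2.
    have da : is_derive b 1 (fun y : R => 1 - y ^+ 2) (- (2 * b)).
      by apply: is_derive_eq; rewrite /GRing.scale /=; ring.
    have DD := @is_derive1_comp _ _ (fun y => 1 - y ^+ 2) _ _ _ dq da.
    by apply: (is_derive_eq DD); rewrite -/(s b); field.
  have du : is_derive b 1 (fun y => (x - y) / s y) ((b * x - 1) / s b ^+ 3).
    have da : is_derive b 1 (fun y : R => x - y) (- 1).
      by apply: is_derive_eq; rewrite /GRing.scale /=; ring.
    have DD := @is_derive_div _ (fun y => x - y) s b _ _ sn da ds.
    apply: (is_derive_eq DD).
    have -> : (b * x - 1) = (b * x - b ^+ 2) - s b ^+ 2 by rewrite sE; ring.
    by field.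
  have dv : is_derive b 1 (fun y => (x + y) / s y) ((b * x + 1) / s b ^+ 3).
    have da : is_derive b 1 (fun y : R => x + y) 1.
      by apply: is_derive_eq; rewrite /GRing.scale /=; ring.
    have DD := @is_derive_div _ (fun y => x + y) s b _ _ sn da ds.
    apply: (is_derive_eq DD).
    have -> : (b * x + 1) = (b * x + b ^+ 2) + s b ^+ 2 by rewrite sE; ring.
    by field.
  have dPu := @is_derive1_comp _ _ (fun y => (x - y) / s y) _ _ _
    (is_derive_Phibar ((x - b) / s b)) du.
  have dPv := @is_derive1_comp _ _ (fun y => (x + y) / s y) _ _ _
    (is_derive_Phibar ((x + b) / s b)) dv.
  have DD := is_deriveN (is_deriveD dPu dPv).
  by apply: (is_derive_eq DD); rewrite /D'; field.
have D'0 (b : R) : 0 < b < a -> 0 <= D' b.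
  move=> /andP[b0 ba]; have s2 : 0 < 1 - b ^+ 2 by apply: sgt0; rewrite !ltW.
  have s0 : 0 < s b by rewrite sqrtr_gt0.
  rewrite divr_ge0 ?exprn_ge0 ?(ltW s0)// subr_ge0.
  rewrite (phi_phi0 (_ / _)) (phi_phi0 ((x + b) / s b)).
  have sqE (e : R) : e ^+ 2 = b ^+ 2 -> expR (- (((x + e) / s b) ^+ 2 / 2)) =
      expR (- ((x ^+ 2 + b ^+ 2) / (2 * (1 - b ^+ 2))))
      * expR (- (e * x / (1 - b ^+ 2))).
    move=> eb; rewrite -expRD; congr expR.
    rewrite expr_div_n sqr_sqrtr ?(ltW s2)// sqrrD eb.
    by field; rewrite gt_eqF.
  rewrite (sqE (- b) (sqrrN b)) (sqE b erefl).
  have -> : - (- b * x / (1 - b ^+ 2)) = b * x / (1 - b ^+ 2) by ring.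
  rewrite [leLHS](_ : _ = phi 0 * expR (- ((x ^+ 2 + b ^+ 2) / (2 * (1 - b ^+ 2))))
    * ((1 - b * x) * expR (b * x / (1 - b ^+ 2)))); last by ring.
  rewrite [leRHS](_ : _ = phi 0 * expR (- ((x ^+ 2 + b ^+ 2) / (2 * (1 - b ^+ 2))))
    * ((1 + b * x) * expR (- (b * x / (1 - b ^+ 2))))); last by ring.
  apply: ler_wpM2l; first by rewrite mulr_ge0 ?expR_ge0// ltW// phi_gt0.
  exact: (split_weight_le x0 x3 (ltW b0) (lt_trans ba a1)).
have := nondecreasing_is_derive a0 dD D'0.
rewrite /D /s expr0n /= !subr0 addr0 sqrtr1 divr1; lra.
Qed.

End GaussianSplit.

(** * Numerical enclosures *)

Section Enclosures.
Variable R : realType.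
Implicit Types x y z : R.

(** The power series in z = x^2 / 2 of the integral of exp (- u^2 / 2) from 0 to x,
divided by x. *)
Definition erf_partial (n : nat) z : R :=
  \sum_(k < n) (-1) ^+ k * z ^+ k / (k`!%:R * k.*2.+1%:R).

Lemma natr_fact7 : (7`!%:R : R) = 720 * 7.
Proof. by rewrite (factS 6) natrM mulrC. Qed.

Lemma natr_fact8 : (8`!%:R : R) = 720 * 7 * 8.
Proof. by rewrite (factS 7) natrM mulrC natr_fact7. Qed.

Lemma natr_fact9 : (9`!%:R : R) = 720 * 7 * 8 * 9.
Proof. by rewrite (factS 8) natrM mulrC natr_fact8. Qed.

Lemma natr_fact10 : (10`!%:R : R) = 720 * 7 * 8 * 9 * 10.
Proof. by rewrite (factS 9) natrM mulrC natr_fact9. Qed.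

(** Larger factorials are kept as products, since a numeral stands for a unary natural. *)
Definition fact_values := (fact0, erefl : 1`! = 1%N, erefl : 2`! = 2%N, erefl : 3`! = 6%N,
  erefl : 4`! = 24%N, erefl : 5`! = 120%N, erefl : 6`! = 720%N).

Definition double_values := (double0, erefl : 1.*2 = 2%N, erefl : 2.*2 = 4%N,
  erefl : 3.*2 = 6%N, erefl : 4.*2 = 8%N, erefl : 5.*2 = 10%N, erefl : 6.*2 = 12%N,
  erefl : 7.*2 = 14%N, erefl : 8.*2 = 16%N, erefl : 9.*2 = 18%N, erefl : 10.*2 = 20%N).

Lemma gauss_partialE n x : gauss_partial n x = x * erf_partial n (x ^+ 2 / 2).
Proof.
rewrite /gauss_partial /erf_partial mulr_sumr; apply: eq_bigr => k _.
rewrite expr_div_n -exprM mul2n exprS.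
have n0 : (k.*2.+1%:R : R) != 0 by rewrite pnatr_eq0.
have f0 : (k`!%:R : R) != 0 by rewrite pnatr_eq0 -lt0n fact_gt0.
have p0 : (2 : R) ^+ k != 0 by rewrite expf_neq0 ?pnatr_eq0.
move: (k.*2.+1%:R : R) n0 => N n0.
by field; rewrite n0 f0 p0.
Qed.

Lemma erf_partialS n z : erf_partial n.+1 z =
  erf_partial n z + (-1) ^+ n * z ^+ n / (n`!%:R * n.*2.+1%:R).
Proof. by rewrite /erf_partial big_ord_recr. Qed.

Lemma erf_partial7 z : erf_partial 7 z = 1 - z / 3 + z ^+ 2 / 10 - z ^+ 3 / 42
  + z ^+ 4 / 216 - z ^+ 5 / (120 * 11) + z ^+ 6 / (720 * 13).
Proof.
rewrite !erf_partialS /erf_partial big_ord0 /= !fact_values !double_values.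
by field.
Qed.

Lemma erf_partial8 z : erf_partial 8 z = erf_partial 7 z - z ^+ 7 / (720 * 7 * 15).
Proof. by rewrite erf_partialS natr_fact7 !double_values; field. Qed.

Lemma erf_partial10 z : erf_partial 10 z = erf_partial 7 z - z ^+ 7 / (720 * 7 * 15)
  + z ^+ 8 / (720 * 7 * 8 * 17) - z ^+ 9 / (720 * 7 * 8 * 9 * 19).
Proof.
by rewrite (erf_partialS 9) (erf_partialS 8) erf_partial8 natr_fact8 natr_fact9 !double_values; field.
Qed.

Lemma erf_partial11 z : erf_partial 11 z = erf_partial 10 z
  + z ^+ 10 / (720 * 7 * 8 * 9 * 10 * 21).
Proof. by rewrite (erf_partialS 10) natr_fact10 !double_values; field. Qed.

Lemma exp_partial7 y : exp_partial 7 y = 1 - y + y ^+ 2 / 2 - y ^+ 3 / 6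
  + y ^+ 4 / 24 - y ^+ 5 / 120 + y ^+ 6 / 720.
Proof.
rewrite /exp_partial !big_ord_recr big_ord0 /= !fact_values.
by field.
Qed.

Lemma exp_partial8 y : exp_partial 8 y = exp_partial 7 y - y ^+ 7 / (720 * 7).
Proof.
rewrite {1}/exp_partial big_ord_recr -/(exp_partial 7 y) /= natr_fact7.
by field.
Qed.

Lemma exp_partial9 y : exp_partial 9 y = exp_partial 8 y + y ^+ 8 / (720 * 7 * 8).
Proof.
rewrite {1}/exp_partial big_ord_recr -/(exp_partial 8 y) /= natr_fact8.
by field.
Qed.

Lemma expR_ge8 y : 0 <= y -> exp_partial 8 y <= expR (- y).
Proof.
by move=> /(exp_partial_alternating 8); rewrite -signr_odd expr0 mul1r subr_ge0.
Qed.

Lemma expR_le9 y : 0 <= y -> expR (- y) <= exp_partial 9 y.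
Proof.
move=> /(exp_partial_alternating 9); rewrite -signr_odd /= expr1 mulN1r opprB.
by rewrite subr_ge0.
Qed.

Lemma expRN1_enclosure : (367 + 85 / 100) / 1000 <= expR (-1 : R) <= (367 + 89 / 100) / 1000.
Proof.
apply/andP; split.
  apply: le_trans (expR_ge8 ler01); rewrite exp_partial8 exp_partial7; lra.
apply: le_trans (expR_le9 ler01) _; rewrite exp_partial9 exp_partial8 exp_partial7.
lra.
Qed.

Lemma Phibar_ge7 x : 0 <= x -> 1 / 2 - phi 0 * (x * erf_partial 7 (x ^+ 2 / 2)) <= Phibar x.
Proof.
move=> /(Phibar_alternating 7); rewrite gauss_partialE -signr_odd /= expr1 mulN1r.
by rewrite oppr_ge0 subr_le0.
Qed.

Lemma Phibar_le8 x : 0 <= x ->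
  Phibar x <= 1 / 2 - phi 0 * (x * erf_partial 8 (x ^+ 2 / 2)).
Proof.
move=> /(Phibar_alternating 8); rewrite gauss_partialE -signr_odd /= expr0 mul1r.
by rewrite subr_ge0.
Qed.

Lemma phi2 : phi (2 : R) = phi 0 * expR (-1) ^+ 2.
Proof.
have e : - ((2 : R) ^+ 2 / 2) = 2%:R * -1 by field.
by rewrite phi_phi0 e expRM_natl.
Qed.

(** The fraction is a convergent of Laplace's continued fraction for Mills ratio; for
a convergent f = N / D the defect f' - x f + 1 is a constant over D^2, whose sign
alternates. *)
Lemma Phibar2_le : Phibar (2 : R) <= phi 2 * (60 / 142).
Proof.
have q0 (z : R) : 2 <= z -> 0 < z ^+ 5 + 10 * z ^+ 3 + 15 * z.
  move=> z2; have z0 : 0 < z by apply: lt_le_trans z2.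
  by rewrite !addr_gt0// ?mulr_gt0// ?exprn_gt0.
pose f (z : R) := (z ^+ 4 + 9 * z ^+ 2 + 8) / (z ^+ 5 + 10 * z ^+ 3 + 15 * z).
have -> : 60 / 142 = f 2 by rewrite /f; field.
apply: (@Phibar_le_of_ode _ f (fun z => ((4 * z ^+ 3 + 18 * z)
   * (z ^+ 5 + 10 * z ^+ 3 + 15 * z) - (z ^+ 4 + 9 * z ^+ 2 + 8) *
   (5 * z ^+ 4 + 30 * z ^+ 2 + 15)) / (z ^+ 5 + 10 * z ^+ 3 + 15 * z) ^+ 2)).
- move=> z z2; apply: is_derive_div; first by rewrite gt_eqF// q0.
    by apply: is_derive_eq; rewrite /GRing.scale /=; ring.
  by apply: is_derive_eq; rewrite /GRing.scale /=; ring.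
- move=> z z2; have := q0 z z2 => q; rewrite -subr_ge0.
  set D := _ - _.
  have -> : D = 120 / (z ^+ 5 + 10 * z ^+ 3 + 15 * z) ^+ 2.
    by rewrite /D /f; field; rewrite gt_eqF.
  exact: divr_ge0 (ler0n _ _) (sqr_ge0 _).
- move=> z z2; rewrite /f divr_ge0 ?(ltW (q0 z z2))//.
  by rewrite !addr_ge0 ?mulr_ge0 ?exprn_ge0//; lra.
Qed.

Lemma Phibar2_ge : phi 2 * (210 / 499) <= Phibar (2 : R).
Proof.
have q0 (z : R) : 2 <= z -> 0 < z ^+ 6 + 15 * z ^+ 4 + 45 * z ^+ 2 + 15.
  move=> z2; have z0 : 0 < z by apply: lt_le_trans z2.
  by rewrite !addr_gt0// ?mulr_gt0// ?exprn_gt0.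
pose f (z : R) := (z ^+ 5 + 14 * z ^+ 3 + 33 * z) / (z ^+ 6 + 15 * z ^+ 4 + 45 * z ^+ 2 + 15).
have -> : 210 / 499 = f 2 by rewrite /f; field.
apply: (@Phibar_ge_of_ode _ f (fun z => ((5 * z ^+ 4 + 42 * z ^+ 2 + 33)
   * (z ^+ 6 + 15 * z ^+ 4 + 45 * z ^+ 2 + 15) - (z ^+ 5 + 14 * z ^+ 3 + 33 * z) *
   (6 * z ^+ 5 + 60 * z ^+ 3 + 90 * z)) / (z ^+ 6 + 15 * z ^+ 4 + 45 * z ^+ 2 + 15) ^+ 2)).
- move=> z z2; apply: is_derive_div; first by rewrite gt_eqF// q0.
    by apply: is_derive_eq; rewrite /GRing.scale /=; ring.
  by apply: is_derive_eq; rewrite /GRing.scale /=; ring.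
- move=> z z2; have := q0 z z2 => q; rewrite -subr_ge0.
  set D := _ - _.
  have -> : D = 720 / (z ^+ 6 + 15 * z ^+ 4 + 45 * z ^+ 2 + 15) ^+ 2.
    by rewrite /D /f; field; rewrite gt_eqF.
  exact: divr_ge0 (ler0n _ _) (sqr_ge0 _).
- move=> z z2; rewrite /f ler_pdivrMr ?q0// mul1r -subr_ge0.
  have -> : z ^+ 6 + 15 * z ^+ 4 + 45 * z ^+ 2 + 15 - (z ^+ 5 + 14 * z ^+ 3 + 33 * z)
    = z ^+ 5 * (z - 1) + z ^+ 3 * (15 * z - 14) + z * (45 * z - 33) + 15 by ring.
  by rewrite !addr_ge0// mulr_ge0 ?exprn_ge0//; lra.
Qed.

(** With I the integral of exp (- u^2 / 2) from 0 to 2 and M Mills ratio at 2, the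
value 1/2 of the tail at 0 is phi 0 (I + exp (-2) M); enclosing I by partial sums
and M by [Phibar2_ge] and [Phibar2_le] encloses phi 0 without reference to pi. *)
Lemma phi0_bounds :
  (398 + 88 / 100) / 1000 <= phi (0 : R) <= (398 + 98 / 100) / 1000.
Proof.
have p0 := phi_gt0 (0 : R).
have /andP[e1 e2] := expRN1_enclosure.
set r := expR (-1) in e1 e2 *.
have r0 : 0 <= r by exact: expR_ge0.
have s1 : ((367 + 85 / 100) / 1000) ^+ 2 <= r ^+ 2.
  by apply: lerXn2r => //; rewrite nnegrE; lra.
have s2 : r ^+ 2 <= ((367 + 89 / 100) / 1000) ^+ 2.
  by apply: lerXn2r => //; rewrite nnegrE; lra.
have U := Phibar2_le; have L := Phibar2_ge; rewrite phi2 -/r in U L.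
have := Phibar_alternating 10 (ler0n R 2).
rewrite -signr_odd expr0 mul1r gauss_partialE => U'.
have := Phibar_alternating 11 (ler0n R 2).
rewrite -signr_odd expr1 mulN1r gauss_partialE => L'.
have E10 : erf_partial 10 ((2 : R) ^+ 2 / 2) = erf_partial 10 2 by congr erf_partial; field.
have E11 : erf_partial 11 ((2 : R) ^+ 2 / 2) = erf_partial 11 2 by congr erf_partial; field.
rewrite E10 erf_partial10 erf_partial7 in U'.
rewrite E11 erf_partial11 erf_partial10 erf_partial7 in L'.
set E := r ^+ 2 in s1 s2 U L.
have t1 : phi 0 * ((367 + 85 / 100) / 1000) ^+ 2 <= phi 0 * E by rewrite ler_pM2l.
have t2 : phi 0 * E <= phi 0 * ((367 + 89 / 100) / 1000) ^+ 2 by rewrite ler_pM2l.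
apply/andP; split; move: p0 t1 t2 U L U' L'; lra.
Qed.

End Enclosures.

(** * Numerical comparisons between the two tails *)

Section NumericalComparisons.
Variable R : realType.
Implicit Types x y z : R.
Notation p := (Phibar (Num.sqrt (2 : R))).

Lemma Phibar_ge_num x (q : R) : 0 <= x -> 0 <= erf_partial 7 (x ^+ 2 / 2) ->
  q <= 1 / 2 - (398 + 98 / 100) / 1000 * (x * erf_partial 7 (x ^+ 2 / 2)) ->
  q <= Phibar x.
Proof.
move=> x0 e0 /le_trans; apply; apply: le_trans (Phibar_ge7 x0).
by rewrite lerB// ler_wpM2r ?mulr_ge0//; case/andP: (@phi0_bounds R).
Qed.

Lemma Phibar_le_num x (q : R) : 0 <= x -> 0 <= erf_partial 8 (x ^+ 2 / 2) ->
  1 / 2 - (398 + 88 / 100) / 1000 * (x * erf_partial 8 (x ^+ 2 / 2)) <= q ->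
  Phibar x <= q.
Proof.
move=> x0 e0; apply: le_trans; apply: (le_trans (Phibar_le8 x0)).
by rewrite lerB// ler_wpM2r ?mulr_ge0//; case/andP: (@phi0_bounds R).
Qed.

Lemma sqrt2_bounds :
  (1414 + 21 / 100) / 1000 <= Num.sqrt (2 : R) <= (1414 + 22 / 100) / 1000.
Proof.
apply/andP; split.
  rewrite -[leLHS]ger0_norm; last lra.
  by rewrite -sqrtr_sqr ler_sqrt; lra.
rewrite -[leRHS]ger0_norm; last lra.
by rewrite -sqrtr_sqr ler_sqrt; lra.
Qed.

Lemma sqrt3_bounds :
  1732 / 1000 <= Num.sqrt (3 : R) <= (1732 + 6 / 100) / 1000.
Proof.
apply/andP; split.
  rewrite -[leLHS]ger0_norm; last lra.
  by rewrite -sqrtr_sqr ler_sqrt; lra.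
rewrite -[leRHS]ger0_norm; last lra.
by rewrite -sqrtr_sqr ler_sqrt; lra.
Qed.

Lemma Phibar_sqrt2_bounds : (78 + 58 / 100) / 1000 <= p <= (78 + 73 / 100) / 1000.
Proof.
have /andP[s1 s2] := sqrt2_bounds.
have e : Num.sqrt (2 : R) ^+ 2 / 2 = 1 by rewrite sqr_sqrtr ?ler0n// divff ?pnatr_eq0.
apply/andP; split.
  apply: Phibar_ge_num; first exact: sqrtr_ge0.
    by rewrite e erf_partial7 !expr1n; lra.
  by rewrite e erf_partial7 !expr1n; lra.
apply: Phibar_le_num; first exact: sqrtr_ge0.
  by rewrite e erf_partial8 erf_partial7 !expr1n; lra.
by rewrite e erf_partial8 erf_partial7 !expr1n; lra.
Qed.

Lemma Phibar_one_ge : 2 * p <= Phibar (1 : R).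
Proof.
have /andP[_ p2] := Phibar_sqrt2_bounds.
apply: Phibar_ge_num; rewrite ?erf_partial7; lra.
Qed.

(** x^2 Phibar x has derivative x k with k = 2 Phibar x - x phi x. As k is
nonincreasing up to sqrt 3, its sign at x decides from which end point of
[1, sqrt 2] the bound comes. *)
Lemma sqr_mul_Phibar_ge x : 1 <= x -> x <= Num.sqrt 2 -> 2 * p <= x ^+ 2 * Phibar x.
Proof.
move=> x1 x2; have s0 : 0 <= Num.sqrt (2 : R) by exact: sqrtr_ge0.
pose k z : R := 2 * Phibar z - z * phi z.
have dk (z : R) : is_derive z 1 k ((z ^+ 2 - 3) * phi z).
  by apply: is_derive_eq; rewrite /GRing.scale /=; ring.
have kanti (y z : R) : 1 <= y -> y <= z -> z <= Num.sqrt 2 -> k z <= k y.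
  move=> y1 yz z2; rewrite -lerN2.
  have dNk (t : R) : y <= t <= z -> is_derive t 1 (fun t => - k t) ((3 - t ^+ 2) * phi t).
    move=> _; have := dk t => dkt.
    by apply: is_derive_eq; ring.
  apply: (nondecreasing_is_derive yz dNk) => t /andP[yt tz].
  rewrite mulr_ge0 ?(ltW (phi_gt0 _))// subr_ge0.
  apply: (@le_trans _ _ 2); last by rewrite ler_nat.
  rewrite -[leRHS](@sqr_sqrtr _ 2) ?ler0n// ler_pXn2r// ?nnegrE//.
    by rewrite (le_trans (ltW tz)).
  by rewrite (le_trans _ (ltW yt))// (le_trans ler01).
have dg (z : R) : is_derive z 1 (fun z => z ^+ 2 * Phibar z) (z * k z).
  by apply: is_derive_eq; rewrite /GRing.scale /k /=; ring.
have [k0|k0] := leP 0 (k x).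
  apply: (@le_trans _ _ (1 ^+ 2 * Phibar 1)).
    by rewrite expr1n mul1r Phibar_one_ge.
  apply: (nondecreasing_is_derive x1 (fun z _ => dg z)) => z /andP[z1 zx].
  rewrite mulr_ge0//; first by rewrite (le_trans ler01 (ltW z1)).
  by apply: le_trans k0 (kanti _ _ _ _ _) => //; exact: ltW.
have -> : 2 * p = Num.sqrt 2 ^+ 2 * p by rewrite sqr_sqrtr ?ler0n.
rewrite -lerN2.
have dNg (z : R) : x <= z <= Num.sqrt 2 ->
    is_derive z 1 (fun z => - (z ^+ 2 * Phibar z)) (- (z * k z)).
  by move=> _; have := dg z => dgz; apply: is_derive_eq.
apply: (nondecreasing_is_derive x2 dNg) => z /andP[xz z2].
rewrite oppr_ge0 mulr_ge0_le0//; first by rewrite (le_trans ler01)// (le_trans x1 (ltW xz)).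
by apply: le_trans (ltW k0); apply: kanti => //; exact: ltW.
Qed.

(** Convexity of the tail on the half-line. *)
Lemma Phibar_tangent x y : 0 <= x -> x <= y -> Phibar y + phi y * (y - x) <= Phibar x.
Proof.
move=> x0 xy.
have dh (z : R) : is_derive z 1 (fun z => - (Phibar z + phi y * z)) (phi z - phi y).
  by apply: is_derive_eq; rewrite /GRing.scale /=; ring.
have h0 (z : R) : x < z < y -> 0 <= phi z - phi y.
  move=> /andP[xz zy]; rewrite subr_ge0 phi_anti// ?ltW//.
  exact: le_lt_trans xz.
have := nondecreasing_is_derive xy (fun z _ => dh z) h0; lra.
Qed.

Lemma sqr_le_num x (q : R) : 0 <= q -> x ^+ 2 <= q ^+ 2 -> x <= q.
Proof.
move=> q0 xq; rewrite leNgt; apply/negP => qx.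
by have := ltrXn2r 2 q0 qx; rewrite ltNge xq.
Qed.

(** For x between sqrt X and r it is enough to compare the bound of
[sgn_tail_hermite] at X with the Gaussian tail at r; 7873/100000 bounds
Phibar (sqrt 2) from above, and the right side of the numerical hypothesis
bounds Phibar r from below. *)
Lemma sgn_tail_cell (l : seq R) (x X r z w L k B : R) : psum 2 l = 1 ->
  (forall a, a \in l -> a ^+ 2 <= 9 / 25) -> 0 < x ->
  X <= x ^+ 2 -> x ^+ 2 <= r ^+ 2 ->
  [&& 0 <= r, 0 <= z, z < X, X < w & 2 * z <= w] ->
  L * ((X - z) * (w - z) ^+ 2) = 1 ->
  k * ((X - z) * (w - z)) = (w - z) + 2 * (X - z) ->
  let h := erf_partial 7 (r ^+ 2 / 2) in
  0 <= h -> 0 <= B ->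
  2 * ((78 + 73 / 100) / 1000) * B <= 1 / 2 - (398 + 98 / 100) / 1000 * (r * h) ->
  let p0 := 1 - L * (1 - k * z) * (w ^+ 2 * X) in
  let p1 := L * ((1 - k * z) * (w ^+ 2 + 2 * w * X) - k * (w ^+ 2 * X)) in
  let p2 := L * (k * (w ^+ 2 + 2 * w * X) - (1 - k * z) * (X + 2 * w)) in
  let p3 := L * (1 - k * z - k * (X + 2 * w)) in
  let p4 := L * k in
  let c0 := p0 + p1 + 3 * p2 + 15 * p3 + 105 * p4 in
  let c1 := - (2 * p2 + 30 * p3 + 420 * p4) in
  let c2 := 16 * p3 + 588 * p4 in
  let c3 := - (272 * p4) in
  [&& c0 <= B, c0 + c1 * (9 / 25) / 3 <= B,
   c0 + 2 * c1 * (9 / 25) / 3 + c2 * (9 / 25) ^+ 2 / 3 <= B &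
   c0 + c1 * (9 / 25) + c2 * (9 / 25) ^+ 2 + c3 * (9 / 25) ^+ 3 <= B] ->
  sgn_tail l x <= Phibar x / (4 * p).
Proof.
move=> l1 lb x0 Xx xr /and5P[r0 z0 zX Xw zw] LE kE h e0 B0 Pr q0 q1 q2 q3 q4 c0 c1 c2 c3.
move=> /and4P[h0 h1 h2 h3].
have /andP[_ p2] := Phibar_sqrt2_bounds.
have p0 : 0 < 4 * p by rewrite mulr_gt0 ?ltr0n// Phibar_gt0.
have b0 : 0 < 9 / 25 :> R by rewrite divr_gt0 ?ltr0n.
apply: (le_trans (sgn_tail_hermite l1 lb x0 Xx z0 zX Xw zw b0 LE kE h0 h1 h2 h3)).
rewrite ler_pdivlMr//.
have := Phibar_ge_num r0 e0 Pr; have := Phibar_anti (sqr_le_num r0 xr).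
have : p * B <= (78 + 73 / 100) / 1000 * B by rewrite ler_wpM2r.
clear; lra.
Qed.

Ltac rational_arith :=
  first [lra | by rewrite ?erf_partial7; lra | by apply/and5P; split; lra
        | by apply/and4P; split; lra].

(** Eight cells cover [sqrt 2, sqrt 3]. In each, z and w are rounded optimal contact
points, L and k are the values that they force, and B is a decimal above the four
Bernstein coefficients. *)
Lemma sgn_tail_small_coeff (l : seq R) x : psum 2 l = 1 ->
  (forall a, a \in l -> a ^+ 2 <= 9 / 25) -> 0 < x -> 2 <= x ^+ 2 -> x ^+ 2 <= 3 ->
  sgn_tail l x <= Phibar x / (4 * p).
Proof.
move=> l1 lb x0 x2 x3.
have [c|/ltW d] := leP (x ^+ 2) ((37 / 25) ^+ 2).
  apply: (@sgn_tail_cell _ x 2 (37 / 25) (1 / 20) 7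
    (20 * 20 * 20 / (39 * 139 * 139)) (20 / 39 + 2 * 20 / 139)
    (436 / 1000) l1 lb x0 x2 c); clear; rational_arith.
have [c|/ltW {}d] := leP (x ^+ 2) ((77 / 50) ^+ 2).
  apply: (@sgn_tail_cell _ x (219 / 100) (77 / 50) (1 / 10) 7
    (100 * 10 * 10 / (209 * 69 * 69)) (100 / 209 + 2 * 10 / 69)
    (388 / 1000) l1 lb x0 (le_trans _ d) c); clear; rational_arith.
have [c|/ltW {}d] := leP (x ^+ 2) ((159 / 100) ^+ 2).
  apply: (@sgn_tail_cell _ x (237 / 100) (159 / 100) (3 / 20) 7
    (50 * 20 * 20 / (111 * 137 * 137)) (50 / 111 + 2 * 20 / 137)
    (350 / 1000) l1 lb x0 (le_trans _ d) c); clear; rational_arith.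
have [c|/ltW {}d] := leP (x ^+ 2) ((163 / 100) ^+ 2).
  apply: (@sgn_tail_cell _ x (63 / 25) (163 / 100) (1 / 5) (15 / 2)
    (25 * 10 * 10 / (58 * 73 * 73)) (25 / 58 + 2 * 10 / 73)
    (324 / 1000) l1 lb x0 (le_trans _ d) c); clear; rational_arith.
have [c|/ltW {}d] := leP (x ^+ 2) ((333 / 200) ^+ 2).
  apply: (@sgn_tail_cell _ x (53 / 20) (333 / 200) (1 / 4) (15 / 2)
    (5 * 4 * 4 / (12 * 29 * 29)) (5 / 12 + 2 * 4 / 29)
    (302 / 1000) l1 lb x0 (le_trans _ d) c); clear; rational_arith.
have [c|/ltW {}d] := leP (x ^+ 2) ((339 / 200) ^+ 2).
  apply: (@sgn_tail_cell _ x (277 / 100) (339 / 200) (3 / 10) (15 / 2)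
    (100 * 5 * 5 / (247 * 36 * 36)) (100 / 247 + 2 * 5 / 36)
    (284 / 1000) l1 lb x0 (le_trans _ d) c); clear; rational_arith.
have [c|/ltW {}d] := leP (x ^+ 2) ((343 / 200) ^+ 2).
  apply: (@sgn_tail_cell _ x (287 / 100) (343 / 200) (3 / 10) 13
    (100 * 10 * 10 / (257 * 127 * 127)) (100 / 257 + 2 * 10 / 127)
    (271 / 1000) l1 lb x0 (le_trans _ d) c); clear; rational_arith.
apply: (@sgn_tail_cell _ x (147 / 50) (1733 / 1000) (3 / 10) 13
    (25 * 10 * 10 / (66 * 127 * 127)) (25 / 66 + 2 * 10 / 127)
    (260 / 1000) l1 lb x0 (le_trans _ d) (le_trans x3 _)); clear; rational_arith.
Qed.

Lemma expRN3_le : expR (3%:R * -1 : R) <= ((367 + 89 / 100) / 1000) ^+ 3.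
Proof.
rewrite expRM_natl; have /andP[_] := @expRN1_enclosure R.
have : 0 <= expR (-1 : R) by exact: expR_ge0.
move: (expR (-1)) => r r0 r2.
by apply: lerXn2r => //; rewrite nnegrE; lra.
Qed.

Lemma Phibar_251_le : Phibar (251 / 100 : R) <= 7 / 1000.
Proof.
have h0 : 0 < 251 / 100 :> R by lra.
apply: (le_trans (Phibar_le_phi_div h0)).
have e3 : expR (- ((251 / 100 : R) ^+ 2 / 2)) <= 44 / 1000.
  apply: (@le_trans _ _ (expR (3%:R * -1) * expR (- (15 / 100)))).
    by rewrite -expRD ler_expR; lra.
  have e0 : 0 <= (15 / 100 : R) by lra.
  have := expR_le9 e0; rewrite exp_partial9 exp_partial8 exp_partial7.
  have := expR_ge0 (- (15 / 100) : R).
  move: (expR (- (15 / 100))) => E E0 E1.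
  by apply: (le_trans (ler_wpM2r E0 expRN3_le)); lra.
have /andP[_ k2] := @phi0_bounds R.
rewrite ler_pdivrMr// phi_phi0.
by apply: (le_trans (ler_pM (ltW (phi_gt0 _)) (expR_ge0 _) k2 e3)); clear; lra.
Qed.

Lemma Phibar_272_le : Phibar (272 / 100 : R) <= 37 / (100 * 100).
Proof.
have h0 : 0 < 272 / 100 :> R by lra.
apply: (le_trans (Phibar_le_phi_div h0)).
have e3 : expR (- ((272 / 100 : R) ^+ 2 / 2)) <= 248 / (100 * 100).
  apply: (@le_trans _ _ (expR (3%:R * -1) * expR (- (699 / 1000)))).
    by rewrite -expRD ler_expR; lra.
  have e0 : 0 <= (699 / 1000 : R) by lra.
  have := expR_le9 e0; rewrite exp_partial9 exp_partial8 exp_partial7.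
  have := expR_ge0 (- (699 / 1000) : R).
  move: (expR (- (699 / 1000))) => E E0 E1.
  by apply: (le_trans (ler_wpM2r E0 expRN3_le)); lra.
have /andP[_ k2] := @phi0_bounds R.
rewrite ler_pdivrMr// phi_phi0.
by apply: (le_trans (ler_pM (ltW (phi_gt0 _)) (expR_ge0 _) k2 e3)); clear; lra.
Qed.

Lemma phi_sqrt3_bounds :
  (88 + 7 / 10) / 1000 <= phi (Num.sqrt (3 : R)) <= (89 + 2 / 10) / 1000.
Proof.
have /andP[k1 k2] := @phi0_bounds R.
have e0 : 0 <= (3 / 2 : R) by lra.
rewrite phi_phi0 sqr_sqrtr ?ler0n//; apply/andP; split.
  have := expR_ge8 e0; rewrite exp_partial8 exp_partial7 => e1.
  have h1 : 0 <= (398 + 88 / 100) / 1000 :> R by clear; lra.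
  have h2 : 2224 / (100 * 100) <= expR (- (3 / 2)) :> R.
    by apply: le_trans e1; clear; lra.
  have h4 : 0 <= 2224 / (100 * 100) :> R by clear; lra.
  by apply: le_trans (ler_pM h1 h4 k1 h2); clear; lra.
have := expR_le9 e0; rewrite exp_partial9 exp_partial8 exp_partial7 => e1.
apply: (le_trans (ler_pM (ltW (phi_gt0 _)) (expR_ge0 _) k2 e1)); clear; lra.
Qed.

Lemma Phibar_sqrt3_bounds :
  414 / (100 * 100) <= Phibar (Num.sqrt (3 : R)) <= 418 / (100 * 100).
Proof.
have /andP[] := sqrt3_bounds; set s := Num.sqrt 3 => sl su.
have s2 : s ^+ 2 = 3 by rewrite sqr_sqrtr ?ler0n.
have s0 : 0 <= s by exact: sqrtr_ge0.
apply/andP; split.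
  by apply: Phibar_ge_num => //; rewrite s2 erf_partial7; clear -su; lra.
by apply: Phibar_le_num => //; rewrite s2 erf_partial8 erf_partial7; clear -sl; lra.
Qed.

(** With q = 4 p, the bounds 1/3 and Phibar v / q for the two conditional tails have
mean at most Phibar x / q. Only the right end sqrt (5/2) of the range matters,
because the left side does not depend on x. *)
Lemma Phibar_room_left x v : 2 <= x ^+ 2 -> x ^+ 2 <= 5 / 2 -> 251 / 100 <= v ->
  4 * p / 3 + Phibar v <= 2 * Phibar x.
Proof.
move=> x2 x5 v0; have /andP[_ p2] := Phibar_sqrt2_bounds.
have hx : x <= 1582 / 1000.
  apply: sqr_le_num; first by clear; lra.
  by apply: le_trans x5 _; clear; lra.
have h1 : 566 / (100 * 100) <= Phibar (1582 / 1000 : R).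
  by clear; apply: Phibar_ge_num; rewrite ?erf_partial7; lra.
have h2 := Phibar_anti hx.
have h3 := Phibar_anti v0; have h4 := Phibar_251_le.
clear -p2 h1 h2 h3 h4; lra.
Qed.

(** Chebyshev's bound 1 / (2 (x^2 - 1)) for one conditional tail exceeds its value 1/4
at sqrt 3 by at most 9/16 (sqrt 3 - x), while the Gaussian side grows at least as
fast, along the tangent at sqrt 3; so sqrt 3 is the worst case. *)
Lemma Phibar_room_right x v : 0 < x -> 5 / 2 <= x ^+ 2 -> x ^+ 2 <= 3 ->
  272 / 100 <= v -> 2 * p / (x ^+ 2 - 1) + Phibar v <= 2 * Phibar x.
Proof.
move=> x0 x5 x3 v0; have /andP[_ p2] := Phibar_sqrt2_bounds.
have /andP[ps _] := phi_sqrt3_bounds; have /andP[Ps _] := Phibar_sqrt3_bounds.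
have /andP[sl su] := sqrt3_bounds.
have s2 : Num.sqrt (3 : R) ^+ 2 = 3 by rewrite sqr_sqrtr ?ler0n.
have s0 : 0 <= Num.sqrt (3 : R) by exact: sqrtr_ge0.
move: (Num.sqrt 3) sl su s2 s0 ps Ps => s sl su s2 s0 ps Ps.
have xs : x <= s by apply: sqr_le_num => //; rewrite s2.
have hx : 158 / 100 <= x.
  apply: sqr_le_num; first exact: ltW.
  by apply: le_trans x5; clear; lra.
have h3 := Phibar_anti v0; have h4 := Phibar_272_le.
have tg := Phibar_tangent (ltW x0) xs.
have p0 : 0 <= p by exact: Phibar_ge0.
move: (Phibar (Num.sqrt 2)) p2 p0 => P p2 p0.
have q0 : 0 < x ^+ 2 - 1 by clear -x5; lra.
have inv : (x ^+ 2 - 1)^-1 <= 1 / 2 + 9 / 8 * (s - x).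
  rewrite -[_^-1]mul1r ler_pdivrMr// -subr_ge0.
  have -> : (1 / 2 + 9 / 8 * (s - x)) * (x ^+ 2 - 1) - 1
    = (s - x) * (9 / 4 - s + (s - x) * (1 / 2 - 9 / 4 * s) + 9 / 8 * (s - x) ^+ 2)
      + (s ^+ 2 - 3) * (1 / 2 + 9 / 8 * (s - x)) by field.
  rewrite s2 subrr mul0r addr0 mulr_ge0 ?subr_ge0//.
  have := sqr_ge0 (s - x).
  have : 0 <= (x - 158 / 100) * (9 / 4 * s - 1 / 2).
    by rewrite mulr_ge0 ?subr_ge0//; clear -sl; lra.
  clear -sl su s2; nra.
have P20 : 0 <= 2 * P by rewrite mulr_ge0.
have i2 := ler_wpM2l P20 inv.
have : 0 <= (2 * phi s - 2 * P * (9 / 8)) * (s - x).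
  by rewrite mulr_ge0 ?subr_ge0//; clear -ps p2; lra.
clear -Ps h3 h4 tg p2 i2; lra.
Qed.

End NumericalComparisons.

(** * The sharp comparison for sign sums *)

Section SharpComparison.
Variable R : realType.
Implicit Types (x y a : R) (l : seq R).
Notation p := (Phibar (Num.sqrt (2 : R))).

(** What is left after splitting off the coefficient a is a sum of total weight
1 - a^2, to be rescaled before the induction hypothesis applies. *)
Lemma sgn_tail_normalize l a : 0 < 1 - a ^+ 2 -> a ^+ 2 + psum 2 l = 1 ->
  exists l', [/\ size l' = size l, psum 2 l' = 1 &
    forall y, sgn_tail l y = sgn_tail l' (y / Num.sqrt (1 - a ^+ 2))].
Proof.
move=> a0 al; set s := Num.sqrt _; have s0 : 0 < s by rewrite sqrtr_gt0.
exists [seq s^-1 * b | b <- l]; split.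
- by rewrite size_map.
- rewrite psum_scale exprVn sqr_sqrtr ?(ltW a0)//.
  have -> : psum 2 l = 1 - a ^+ 2 by rewrite -al addrAC subrr add0r.
  by rewrite mulVf// gt_eqF.
- by move=> y; rewrite mulrC sgn_tail_scale// invr_gt0.
Qed.

(** A coefficient of square 1 leaves only zeros, and Chebyshev then gives 0. *)
Lemma sgn_tail_unit_head l a x : a ^+ 2 = 1 -> 0 <= a -> a ^+ 2 + psum 2 l = 1 ->
  1 < x -> sgn_tail (a :: l) x <= 0.
Proof.
move=> a1 a0 al x1; have l0 : psum 2 l = 0 by move: al; rewrite a1; lra.
have aE : a = 1.
  by apply/eqP; rewrite -(@eqrXn2 _ 2)// a1 expr1n.
rewrite sgn_tail_cons aE.
have h1 : 0 < x - 1 by rewrite subr_gt0.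
have h2 : 0 < x + 1 by rewrite addr_gt0// (lt_trans ltr01).
have := chebyshev_sgn_tail l h1; have := chebyshev_sgn_tail l h2.
rewrite l0 !mul0r; lra.
Qed.

Lemma sgn_tail_le_Phibar l x : psum 2 l = 1 -> sgn_tail l x <= Phibar x / (4 * p).
Proof.
have /andP[plo pup] := @Phibar_sqrt2_bounds R.
have pgt0 : 0 < p by exact: Phibar_gt0.
have p0 : 0 < 4 * p by rewrite mulr_gt0.
elim: {l}(size l) {-2}l (leqnn (size l)) x => [|n IH] l sl x l1.
  move: sl l1; rewrite leqn0 size_eq0 => /eqP ->.
  by rewrite psum_nil => /esym/eqP; rewrite oner_eq0.
rewrite ler_pdivlMr//.
have [x0|x0] := leP x 0.
  have := sgn_tail_le1 l x; rewrite -(ler_pM2r p0) mul1r.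
  have := Phibar_anti x0; rewrite Phibar0; clear -pup; lra.
have [x1|x1] := leP x 1.
  have := sgn_tail_le_half l x0; rewrite -(ler_pM2r p0).
  have := Phibar_anti x1; have := @Phibar_one_ge R; clear; lra.
have s20 : 0 <= Num.sqrt (2 : R) by exact: sqrtr_ge0.
have s22 : Num.sqrt (2 : R) ^+ 2 = 2 by rewrite sqr_sqrtr ?ler0n.
have [x2|x2] := leP x (Num.sqrt 2).
  have := chebyshev_sgn_tail l x0; rewrite l1 -(ler_pM2r p0) => /le_trans; apply.
  have U := sqr_mul_Phibar_ge (ltW x1) x2.
  have x20 : 0 < x ^+ 2 by rewrite exprn_gt0.
  have -> : 1 / (2 * x ^+ 2) * (4 * p) = (2 * p) / x ^+ 2 by field; rewrite gt_eqF.
  by rewrite ler_pdivrMr// [leRHS]mulrC.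
have x22' : 2 < x ^+ 2 by rewrite -s22 ltrXn2r// ltW.
have x22 := ltW x22'.
(* either the coefficient a carries all the weight and the tail vanishes, or
   the tail is the mean of two tails of a shorter normalised list *)
have strip a l' : perm_eq l (a :: l') -> exists b, [/\ 0 <= b, b ^+ 2 = a ^+ 2 &
    sgn_tail l x <= 0 \/ b < 1 /\ b ^+ 2 + psum 2 l' = 1 /\
    exists l'', [/\ (size l'' <= n)%N, psum 2 l'' = 1,
      forall y, sgn_tail l' y = sgn_tail l'' (y / Num.sqrt (1 - b ^+ 2)) &
      sgn_tail l x = (sgn_tail l' (x - b) + sgn_tail l' (x + b)) / 2]].
  move=> pl; exists `|a|; split; [by []|by rewrite real_normK ?num_real|].
  have tE : sgn_tail l x = sgn_tail (`|a| :: l') x.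
    by rewrite sgn_tail_norm; exact: perm_sgn_mean.
  have aE : `|a| ^+ 2 + psum 2 l' = 1.
    by rewrite real_normK ?num_real// -l1 (perm_psum _ pl) psum_cons.
  move: `|a| (normr_ge0 a) aE tE => b b0 bE tE.
  have b21 : b ^+ 2 <= 1 by rewrite -bE lerDl psum2_ge0.
  move: b21; rewrite le_eqVlt => /orP[/eqP b1|b1].
    by left; rewrite tE; apply: sgn_tail_unit_head.
  right; split; first by move: b1; rewrite expr_lt1.
  split; first exact: bE.
  have q0 : 0 < 1 - b ^+ 2 by rewrite subr_gt0.
  have [l'' [h1 h2 h3]] := sgn_tail_normalize q0 bE.
  exists l''; split => //.
    by rewrite h1; move: sl; rewrite (perm_size pl).
  by rewrite tE sgn_tail_cons.
have P0 : 0 <= Phibar x by exact: Phibar_ge0.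
have [x3|x3] := leP 3 (x ^+ 2).
  have [a [l' lE]] : exists a l', l = a :: l'.
    move: l1; case: (l) => [|a l' _]; last by exists a, l'.
    by rewrite psum_nil => /esym/eqP; rewrite oner_eq0.
  have [|b [b0 _ [le0|[b1 [_ [l'' [h1 h2 h3 h4]]]]]]] := @strip a l'.
  - by rewrite lE.
  - by apply: le_trans P0; rewrite mulr_le0_ge0// ltW.
  rewrite h4 !h3.
  have := Phibar_split_le (ltW x0) x3 b0 b1.
  have := IH l'' h1 ((x - b) / Num.sqrt (1 - b ^+ 2)) h2.
  have := IH l'' h1 ((x + b) / Num.sqrt (1 - b ^+ 2)) h2.
  rewrite !ler_pdivlMr//.
  clear; lra.
have [/hasP[a al a2]|/hasPn H] := boolP (has (fun a => 9 / 25 < a ^+ 2) l); last first.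
  rewrite -ler_pdivlMr//; apply: sgn_tail_small_coeff => //; last exact: ltW.
  by move=> a /H; rewrite -leNgt.
have [|b [b0 ba [le0|[b1 [bE [l'' [h1 h2 h3 h4]]]]]]] := @strip a (rem a l).
- exact: perm_to_rem.
- by apply: le_trans P0; rewrite mulr_le0_ge0// ltW.
rewrite -ba in a2; set l' := rem a l in bE h3 h4.
have b35 : 3 / 5 < b.
  rewrite ltNge; apply/negP => bs.
  have : b ^+ 2 <= (3 / 5) ^+ 2 by apply: lerXn2r => //; rewrite nnegrE; lra.
  by clear -a2; lra.
have q0 : 0 < 1 - b ^+ 2 by rewrite subr_gt0 expr_lt1.
have h3u := h3 (x - b); have h3v := h3 (x + b).
have s2 : Num.sqrt (1 - b ^+ 2) ^+ 2 = 1 - b ^+ 2 by rewrite sqr_sqrtr// ltW.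
have s0 : 0 < Num.sqrt (1 - b ^+ 2) by rewrite sqrtr_gt0.
move: (Num.sqrt (1 - b ^+ 2)) s2 s0 h3u h3v => s s2 s0 h3u h3v.
have s45 : s <= 4 / 5.
  apply: sqr_le_num; first by clear; lra.
  by rewrite s2; clear -a2; lra.
have xb : 0 < x - b by rewrite subr_gt0 (lt_trans b1).
(* (x + b) / sqrt (1 - b^2) increases with b, so b = 3/5 gives a lower bound *)
have vge (c : R) : c <= x -> (c + 3 / 5) * (5 / 4) <= (x + b) / s.
  move=> cx; rewrite ler_pdivlMr//.
  apply: (@le_trans _ _ ((x + 3 / 5) * (5 / 4) * s)).
    by rewrite ler_wpM2r ?(ltW s0)//; clear -cx; lra.
  rewrite -mulrA; apply: (@le_trans _ _ ((x + 3 / 5) * 1)).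
    apply: ler_wpM2l; first by clear -x0; lra.
    by clear -s45; lra.
  by clear -b35; lra.
have hv : sgn_tail l' (x + b) * (4 * p) <= Phibar ((x + b) / s).
  by rewrite h3v -ler_pdivlMr//; exact: IH.
have [x5|x5] := leP (x ^+ 2) (5 / 2).
  have v251 : 251 / 100 <= (x + b) / s.
    apply: le_trans (vge _ (ltW x2)).
    by have /andP[] := @sqrt2_bounds R; clear; lra.
  have := Phibar_room_left x22 x5 v251.
  have : sgn_tail l' (x - b) <= 1 / 3.
    rewrite h3u; apply: sgn_tail_le_third => //.
    rewrite ltr_pdivlMr// mul1r -(@ltr_pXn2r _ 2%N) ?nnegrE ?(ltW s0) ?(ltW xb)//.
    rewrite s2 -subr_gt0.
    (* (x - b)^2 + b^2 - 1 = ((2 b - x)^2 + x^2 - 2) / 2 *)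
    have := sqr_ge0 (2 * b - x); clear -x22'; lra.
  rewrite -(ler_pM2r p0) h4; move: hv; clear; lra.
have v272 : 272 / 100 <= (x + b) / s.
  have x158 : 158 / 100 <= x.
    apply: sqr_le_num; first exact: ltW.
    by apply: le_trans (ltW x5); clear; lra.
  by apply: le_trans (vge _ x158); clear; lra.
have := Phibar_room_right x0 (ltW x5) (ltW x3) v272.
have : sgn_tail l' (x - b) <= 1 / (2 * (x ^+ 2 - 1)).
  apply: (le_trans (chebyshev_sgn_tail _ xb)).
  have -> : psum 2 l' = 1 - b ^+ 2 by rewrite -bE addrAC subrr add0r.
  have q1 : 0 < x ^+ 2 - 1 by clear -x22; lra.
  rewrite ler_pdivrMr ?mulr_gt0 ?exprn_gt0//.
  rewrite mulrAC ler_pdivlMr ?mulr_gt0//.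
  (* (x - b)^2 - (1 - b^2) (x^2 - 1) = (b x - 1)^2 *)
  have := sqr_ge0 (b * x - 1); clear; lra.
have q1 : 0 < x ^+ 2 - 1 by clear -x22; lra.
have -> : 1 / (2 * (x ^+ 2 - 1)) = (x ^+ 2 - 1)^-1 / 2 by field; rewrite gt_eqF.
rewrite -(ler_pM2r p0) h4; move: hv; clear; lra.
Qed.

End SharpComparison.

(** * From Rademacher variables to sign averages *)

Lemma one_neqN1 (R : realFieldType) : 1 <> -1 :> R.
Proof. by move=> e; exfalso; lra. Qed.

Section Independence.
Context (R : realType) (d : measure_display) (T : measurableType d)
  (P : probability T R) (n : nat) (a : 'I_n -> R) (eps : 'I_n -> {RV P >-> R}).
Context (indep : mutually_independent eps) (rad : forall i, rademacher (eps i)).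

Local Notation S := (fun w => \sum_(i < n) a i * eps i w).

Let measurable_level i c : measurable [set w | eps i w = c].
Proof.
have -> : [set w | eps i w = c] = eps i @^-1` [set c] by [].
exact: measurable_funPTI.
Qed.

Let measurable_tail x : measurable [set w | x <= S w].
Proof.
have -> : [set w | x <= S w] = S @^-1` `[x, +oo[.
  by apply/seteqP; split => w /=; rewrite in_itv /= andbT.
rewrite -[X in measurable X]setTI; apply: measurable_sum => // i.
exact: measurable_funM.
Qed.

Definition signs_outside (r : seq 'I_n) (s : 'I_n -> R) : set T :=
  [set w | forall i, i \notin r -> eps i w = s i].

Let measurable_signs r s : measurable (signs_outside r s).
Proof.
have -> : signs_outside r s =
    \bigcap_(i in [set i | i \notin r]) [set w | eps i w = s i].
  by [].
apply: fin_bigcap_measurable => //; exact: finite_finset.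
Qed.

Let split_sign i (A : set T) : measurable A ->
  P A = (P (A `&` [set w | eps i w = 1%R]) + P (A `&` [set w | eps i w = (-1)%R]))%E.
Proof.
move=> mA; have [r1 rN1] := rad i.
pose U := [set w | eps i w = 1] `|` [set w | eps i w = -1].
have mU : measurable U by apply: measurableU.
have disj : [set w | eps i w = 1] `&` [set w | eps i w = -1] = set0.
  by apply/seteqP; split => w //= [-> /one_neqN1].
have PU : P U = 1%E.
  by rewrite measureU//= r1 rN1 -EFinD; congr (_%:E); field.
have PUC : P (~` U) = 0%E by rewrite probability_setC// PU subee.
transitivity (P (A `\` U) + P (A `&` U))%E; first exact: measureDI.
have -> : P (A `\` U) = 0%E.
  apply/eqP; rewrite -measure_le0 -PUC; apply: le_measure; rewrite ?inE//.
    exact: measurableD.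
  by apply: measurableC.
rewrite add0e /U setIUr measureU//; [exact: measurableI|exact: measurableI|].
by rewrite setIACA setIid disj setI0.
Qed.

Let prob_signs s : (forall i, s i = 1 \/ s i = -1) ->
  P (signs_outside [::] s) = ((2^-1) ^+ n)%:E.
Proof.
move=> s1.
have := @indep [set: 'I_n]%SET (fun i => [set s i]) (fun i => measurable_set1 _).
have -> : [set w | forall i, i \in [set: 'I_n]%SET -> [set s i] (eps i w)] = signs_outside [::] s.
  by apply/seteqP; split => w H i hi; apply: H; rewrite ?inE.
move=> ->; rewrite (eq_bigr (fun=> (2^-1)%:E)).
  by rewrite prodEFin prodr_const cardsT card_ord.
by move=> i _; case: (s1 i) => ->; have [] := rad i.
Qed.

(** Induction on the list r of signs still free. With none free, independence gives
the probability of the pattern; freeing one sign splits the event in two, up to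
the null event where the variable is not a sign. *)
Lemma prob_tail_given_signs (r : seq 'I_n) (s : 'I_n -> R) x : uniq r ->
  (forall i, s i = 1 \/ s i = -1) ->
  P (signs_outside r s `&` [set w | x <= S w]) =
  ((2^-1) ^+ (n - size r) *
   sgn_tail [seq a i | i <- r] (x - \sum_(i < n | i \notin r) a i * s i))%:E.
Proof.
elim: r s => [|i r IH] s ur s1.
  rewrite subn0 /sgn_tail /= subr_le0.
  have SE w : signs_outside [::] s w -> S w = \sum_(i < n) a i * s i.
    by move=> H; apply: eq_bigr => j _; rewrite H.
  have [xs|xs] := boolP (x <= _).
    rewrite mulr1 -(prob_signs s1); congr (P _).
    by apply/seteqP; split => w; [case|move=> H; split; rewrite //= SE].
  rewrite mulr0 (_ : _ `&` _ = set0) ?measure0//.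
  apply/seteqP; split => w // -[H /=]; rewrite SE// => h; move: xs.
  by rewrite h.
have /andP[ir ur'] := ur.
have sz : (size r < n)%N.
  by have := uniq_leq_size ur (fun j _ => mem_enum 'I_n j); rewrite size_enum_ord.
pose s_ e := fun j => if j == i then e else s j.
have s_1 e : e = 1 \/ e = -1 -> forall j, s_ e j = 1 \/ s_ e j = -1.
  by move=> e1 j; rewrite /s_; case: eqP.
have key e : e = 1 \/ e = -1 ->
  P (signs_outside (i :: r) s `&` [set w | x <= S w] `&` [set w | eps i w = e]) =
  ((2^-1) ^+ (n - size r) * sgn_tail [seq a i | i <- r]
    (x - \sum_(j < n | j \notin i :: r) a j * s j - a i * e))%:E.
  move=> e1; rewrite setIAC.
  have -> : signs_outside (i :: r) s `&` [set w | eps i w = e] = signs_outside r (s_ e).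
    apply/seteqP; split => w.
      move=> [H ei] j jr; rewrite /s_; case: eqP => [->//|/eqP ji].
      by apply: H; rewrite inE negb_or ji.
    move=> H; split => [j|/=].
      rewrite inE negb_or => /andP[ji jr]; rewrite H// /s_.
      by rewrite (negbTE ji).
    by rewrite H// /s_ eqxx.
  rewrite IH//; last exact: s_1.
  congr ((_ * sgn_tail _ _)%:E).
  rewrite (bigD1 i)//= {1}/s_ eqxx opprD addrA addrAC; congr (_ - _ - _).
  apply: eq_big => j; first by rewrite inE negb_or andbC.
  by move=> /andP[_ ji]; rewrite /s_ (negbTE ji).
rewrite (split_sign i); last exact: measurableI.
rewrite key; last by left.
rewrite key; last by right.
rewrite -EFinD /= sgn_tail_cons; congr (_%:E).
rewrite mulrN1 opprK mulr1 -mulrDr -(subnSK sz) exprS.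
by rewrite [2^-1 * _]mulrC -!mulrA [_ / 2]mulrC.
Qed.

Lemma prob_sgn_tail x :
  P [set w | x <= S w] = (sgn_tail [seq a i | i <- enum 'I_n] x)%:E.
Proof.
have := @prob_tail_given_signs (enum 'I_n) (fun=> 1) x (enum_uniq _)
  (fun _ => or_introl erefl).
rewrite size_enum_ord subnn expr0 mul1r big1 ?subr0.
  move=> <-; congr (P _); apply/seteqP; split => w //=; last by case.
  by move=> H; split => // i; rewrite mem_enum.
by move=> i; rewrite mem_enum.
Qed.

End Independence.

(** * Two fair coins and the constants *)

Lemma sgn_tail_pair_ge (R : realFieldType) (b : R) :
  1 / 4 <= sgn_tail [:: b; b] (b + b).
Proof.
have h0 := sgn_tail_ge0 [::] (b + b - b + b).
have h1 := sgn_tail_ge0 [::] (b + b + b - b).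
have h2 := sgn_tail_ge0 [::] (b + b + b + b).
have h3 : sgn_tail [::] (b + b - b - b) = 1.
  by rewrite /sgn_tail /= addrK subrr lexx.
by rewrite !sgn_tail_cons h3; lra.
Qed.

Section TwoCoins.
Variable R : realType.
Notation p := (Phibar (Num.sqrt (2 : R))).

Definition two_coins : probability (bool * bool)%type R :=
  (bernoulli_prob (2^-1 : R) \x bernoulli_prob (2^-1 : R))%E.

Definition coin (i : 'I_2) (w : bool * bool) : R :=
  if (if i == ord0 then w.1 else w.2) then 1 else -1.

Lemma measurable_coin i : measurable_fun setT (coin i).
Proof.
have m1 : measurable_fun [set: bool] (fun b : bool => if b then 1 else -1 : R).
  by [].
rewrite /coin; case: (i == ord0).
  exact: (measurableT_comp m1 measurable_fst).
exact: (measurableT_comp m1 measurable_snd).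
Qed.

HB.instance Definition _ i :=
  @isMeasurableFun.Build _ _ _ _ (coin i) (measurable_coin i).

Definition coin_rv (i : 'I_2) : {RV two_coins >-> R} := coin i.

Lemma bernoulli_half (b : bool) : bernoulli_prob (2^-1 : R) [set b] = (2^-1)%:E.
Proof.
rewrite bernoulli_probE; last by lra.
have h : onem (2^-1 : R) = 2^-1 by rewrite /onem; lra.
rewrite h !diracE !in_set1 -!EFinM -EFinD.
by congr (_%:E); case: (b) => /=; rewrite mulr1 mulr0 ?addr0 ?add0r.
Qed.

Lemma two_coinsX (A B : set bool) :
  two_coins (A `*` B) = (bernoulli_prob (2^-1 : R) A * bernoulli_prob (2^-1 : R) B)%E.
Proof. by rewrite /two_coins /= product_measure1E. Qed.

Lemma coin_preimage0 (B : set R) :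
  coin ord0 @^-1` B = [set b : bool | B (if b then 1 else -1)] `*` setT.
Proof. by apply/seteqP; split => w; rewrite /coin /=; [|case]. Qed.

Lemma coin_preimage1 (B : set R) :
  coin (lift ord0 ord0) @^-1` B = setT `*` [set b : bool | B (if b then 1 else -1)].
Proof. by apply/seteqP; split => w; rewrite /coin /=; [|case]. Qed.

Lemma rademacher_coin i : rademacher (coin_rv i).
Proof.
have sgn1 (e : R) (b0 : bool) : e = (if b0 then 1 else -1) ->
    [set b : bool | (if b then 1 else -1) = e] = [set b0].
  move=> ->; apply/seteqP; split => b /=; last by move=> ->.
  case: b b0 => [] [] //; first by move/one_neqN1.
  by move/esym/one_neqN1.
have H e b0 : e = (if b0 then 1 else -1) ->
    two_coins [set w | coin_rv i w = e] = (2^-1)%:E.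
  move=> eb.
  have -> : [set w | coin_rv i w = e] = coin i @^-1` [set e] by [].
  have [->|->] : i = ord0 \/ i = lift ord0 ord0.
  - by case: i => [[|[|//]]] hi; [left|right]; apply/val_inj.
  - rewrite coin_preimage0 two_coinsX /= (sgn1 e b0)// bernoulli_half.
    by rewrite probability_setT mule1.
  - rewrite coin_preimage1 two_coinsX /= (sgn1 e b0)// bernoulli_half.
    by rewrite probability_setT mul1e.
by split; [exact: (H 1 true)|exact: (H (-1) false)].
Qed.

Lemma independent_coins : mutually_independent coin_rv.
Proof.
move=> J B mB.
pose C i : set bool := if i \in J then [set b | B i (if b then 1 else -1)] else setT.
have -> : [set w | forall i, i \in J -> B i (coin_rv i w)] = C ord0 `*` C (lift ord0 ord0).
  apply/seteqP; split => w.
    move=> H; split; rewrite /C; case: ifPn => //= iJ.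
      exact: (H ord0).
    exact: (H (lift ord0 ord0)).
  case; rewrite /C => H0 H1 i iJ.
  have iE : i = ord0 \/ i = lift ord0 ord0.
    by case: (i) => [[|[|//]]] hi; [left|right]; apply/val_inj.
  by case: iE iJ => -> iJ; [move: H0|move: H1]; rewrite iJ.
have PX0 : two_coins (coin_rv ord0 @^-1` B ord0) =
    bernoulli_prob 2^-1 [set b | B ord0 (if b then 1 else -1)].
  have -> : coin_rv ord0 @^-1` B ord0 = coin ord0 @^-1` B ord0 by [].
  by rewrite coin_preimage0 two_coinsX probability_setT mule1.
have PX1 : two_coins (coin_rv (lift ord0 ord0) @^-1` B (lift ord0 ord0)) =
    bernoulli_prob 2^-1 [set b | B (lift ord0 ord0) (if b then 1 else -1)].
  have -> : coin_rv (lift ord0 ord0) @^-1` B (lift ord0 ord0) =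
    coin (lift ord0 ord0) @^-1` B (lift ord0 ord0) by [].
  by rewrite coin_preimage1 two_coinsX probability_setT mul1e.
rewrite two_coinsX big_mkcond big_ord_recl big_ord1 /C.
by congr (_ * _)%E; case: ifP; rewrite ?PX0 ?PX1 ?probability_setT.
Qed.

(** Two coefficients 1 / sqrt 2 reach sqrt 2 when both coins agree on heads, which has
probability 1/4. *)
Lemma admissible_ge_c1 (c : R) : admissible c -> c1 R <= c.
Proof.
move=> adm; have s0 : 0 < Num.sqrt (2 : R) by rewrite sqrtr_gt0.
have s2 : Num.sqrt (2 : R) ^+ 2 = 2 by rewrite sqr_sqrtr ?ler0n.
pose a := fun _ : 'I_2 => (Num.sqrt (2 : R))^-1.
have a1 : \sum_(i < 2) a i ^+ 2 = 1.
  by rewrite big_ord_recl big_ord1 /a exprVn s2; field.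
have := adm 2%N a (ltn0Sn _) a1 _ _ two_coins coin_rv independent_coins rademacher_coin
  (Num.sqrt 2).
rewrite (prob_sgn_tail _ independent_coins rademacher_coin) lee_fin.
have -> : [seq a i | i <- enum 'I_2] = [:: (Num.sqrt 2)^-1; (Num.sqrt 2)^-1].
  by case: (enum 'I_2) (size_enum_ord 2) => [|i [|j []]].
move=> h; have pgt0 : 0 < p by exact: Phibar_gt0.
rewrite /c1 ler_pdivrMr ?mulr_gt0//.
suff /le_trans/(_ h) : 1 / 4 <=
    sgn_tail [:: (Num.sqrt (2 : R))^-1; (Num.sqrt 2)^-1] (Num.sqrt 2).
  by clear; lra.
suff sE : Num.sqrt 2 = (Num.sqrt (2 : R))^-1 + (Num.sqrt 2)^-1.
  by rewrite [X in sgn_tail _ X]sE sgn_tail_pair_ge.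
have -> : (Num.sqrt (2 : R))^-1 = Num.sqrt 2 / 2.
  by rewrite -{3}s2 expr2 invfM mulVKf// gt_eqF.
by field.
Qed.

Lemma admissible_c1 : admissible (c1 R).
Proof.
move=> n a n0 a1 d T P eps ind rad x.
rewrite (prob_sgn_tail _ ind rad) lee_fin /c1 -mulrA mul1r mulrC.
apply: sgn_tail_le_Phibar.
by rewrite /psum big_map big_enum.
Qed.

Lemma mills_sqrt3_bounds : 212 / 100 <= mills (Num.sqrt (3 : R)) <= 22 / 10.
Proof.
have /andP[h1 h2] := @phi_sqrt3_bounds R.
have /andP[h3 h4] := @Phibar_sqrt3_bounds R.
have h0 : 0 < Phibar (Num.sqrt (3 : R)) by exact: Phibar_gt0.
rewrite /mills; apply/andP; split.
  by rewrite ler_pdivlMr//; clear -h1 h2 h3 h4; lra.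
by rewrite ler_pdivrMr//; clear -h1 h2 h3 h4; lra.
Qed.

Lemma c1_bounds : (317 + 54 / 100) / 100 <= c1 R <= (318 + 15 / 100) / 100.
Proof.
have /andP[h1 h2] := @Phibar_sqrt2_bounds R.
have h0 : 0 < 4 * p by rewrite mulr_gt0// Phibar_gt0.
rewrite /c1; apply/andP; split.
  by rewrite (ler_pdivlMr _ _ h0); clear -h1 h2; lra.
by rewrite (ler_pdivrMr _ _ h0); clear -h1 h2; lra.
Qed.

End TwoCoins.

Theorem theorem1 (R : realType) :
  (exists c_star : R,
     is_least_admissible c_star /\ c1 R <= c_star <= c2 R) /\
  [/\ approx2 (c1 R) 318, approx2 (c2 R) 322 & approx2 (c2 R / c1 R) 101].
Proof.
have /andP[cl cu] := c1_bounds R.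
have /andP[ml mu] := mills_sqrt3_bounds R.
have c0 : 0 < c1 R by apply: lt_le_trans cl; lra.
have c2E : c2 R = c1 R * (1 + 1 / 250 * (1 + mills (Num.sqrt 3))) by [].
move: (mills _) ml mu c2E => m ml mu c2E.
split.
  exists (c1 R); split; first by split; [exact: admissible_c1|exact: admissible_ge_c1].
  rewrite lexx /= c2E ler_peMr ?(ltW c0)//; lra.
have c21 : c2 R / c1 R = 1 + 1 / 250 * (1 + m).
  by rewrite c2E mulrAC divff ?mul1r// gt_eqF.
have l2 : c1 R * (1 + 1 / 250 * (1 + 212 / 100)) <= c2 R.
  by rewrite c2E ler_pM2l//; lra.
have u2 : c2 R <= c1 R * (1 + 1 / 250 * (1 + 22 / 10)).
  by rewrite c2E ler_pM2l//; lra.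
rewrite /approx2 c21; split; rewrite ler_norml; apply/andP; split; lra.
Qed.
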